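(* Let $\theta$ be an inner function and $g\in L^\infty(\mathbb{T})$, and assume that $\ker D_g^\theta$ is finite dimensional. Let $A=\{f\in\ker D_g^\theta : gf\in K_\theta\cap zH^2\}$ and $C=\ker D_g^\theta\cap(\overline{H^2_0}\oplus\theta zH^2)\cap A$. 1. If $\dim(g\ker D_g^\theta\ominus gC)=2$, then, with $gf_0,gh_0$ (where $f_0,h_0\in\ker D_g^\theta$) orthonormal basis elements of $g\ker D_g^\theta\ominus gC$, $$g\ker D_g^\theta=\begin{pmatrix}gf_0&gh_0\end{pmatrix}K,$$ where $K$ is a closed $S^*$-invariant subspace of $H^2(\mathbb{D},\mathbb{C}^2)$, and for $f\in\ker D_g^\theta$, with $gf=gf_0k_0+gh_0k_1$ and $\begin{pmatrix}k_0\\k_1\end{pmatrix}\in K$, we have $\|gf\|_{H^2}^2=\|k_0\|_{H^2}^2+\|k_1\|_{H^2}^2$. 2. If $\dim(g\ker D_g^\theta\ominus gC)=1$, then, with $gf_0$ (where $f_0\in\ker D_g^\theta$) a normalised element of $g\ker D_g^\theta\ominus gC$, $$g\ker D_g^\theta=gf_0K_{\chi z},$$ where $\chi$ is some inner function, and for $f\in\ker D_g^\theta$, with $gf=gf_0k$ and $k\in K_{\chi z}$, we have $\|gf\|_{H^2}^2=\|k\|_{H^2}^2$.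
   Context: $H^2$ is the Hardy space of the unit disc $\mathbb{D}$, identified with its boundary functions in $L^2=L^2(\mathbb{T})$, and $H^2(\mathbb{D},\mathbb{C}^2)$ is the space of column vectors of length 2 with entries in $H^2$. $\overline{H^2_0}=\{\overline f : f\in H^2,f(0)=0\}$. For an inner function $I$, $K_I=I\overline{H^2_0}\cap H^2$. In $L^2$, $K_\theta^\perp=\overline{H^2_0}\oplus\theta H^2$; let $Q$ be the orthogonal projection of $L^2$ onto $K_\theta^\perp$. The dual truncated Toeplitz operator $D_g^\theta:K_\theta^\perp\to K_\theta^\perp$ is $D_g^\theta f=Q(gf)$ (so $gf\in K_\theta$ for $f\in\ker D_g^\theta$). $gX=\{gf:f\in X\}$. The backward shift is $S^*F(z)=(F(z)-F(0))/z$ (entrywise). *)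

(* Defs.v *)
From mathcomp Require Import all_boot all_order all_algebra.
From mathcomp Require Import complex.
From mathcomp Require Import all_classical all_reals all_analysis.

Set Implicit Arguments.
Unset Strict Implicit.
Unset Printing Implicit Defensive.

Import Order.TTheory GRing.Theory Num.Theory.
Import numFieldNormedType.Exports.

Local Open Scope classical_set_scope.
Local Open Scope complex_scope.
Local Open Scope ring_scope.

(* A function on the unit circle is represented by a function on R[i], of which
   only the values at the points exp(it), 0 <= t <= 2 pi, are ever used.
   Elements of L^2 are functions, not classes: equality in L^2 is circle_ae. *)

Section L2.
Variable R : realType.
Local Notation C := R[i].
Local Notation mu := (@lebesgue_measure R).
Implicit Types (f g h : C -> C) (z : C).

Definition cis (t : R) : C := cos t +i* sin t.

Definition angles : set R := `[0, 2 * pi]%classic.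

Definition circle_measurable f : Prop :=
  measurable_fun angles (fun t => complex.Re (f (cis t))) /\
  measurable_fun angles (fun t => complex.Im (f (cis t))).

Definition circle_ae f g : Prop := ae_eq mu angles (f \o cis) (g \o cis).

(* Integral against normalised arc length, dt / (2 pi). *)
Definition circle_int f : C :=
  ((2 * pi)^-1 * Rintegral mu angles (fun t => complex.Re (f (cis t)))) +i*
  ((2 * pi)^-1 * Rintegral mu angles (fun t => complex.Im (f (cis t)))).

Definition L2 f : Prop :=
  circle_measurable f /\
  (\int[mu]_(t in angles) ((Normc.normc (f (cis t)) ^+ 2)%:E) < +oo)%E.

Definition Linfty f : Prop :=
  circle_measurable f /\
  exists M : R, {ae mu, forall t, angles t -> Normc.normc (f (cis t)) <= M}.

Definition inner f g : C := circle_int (fun z => f z * (g z)^*%C).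

Definition normL2 f : R := Num.sqrt (complex.Re (inner f f)).

(* The Fourier coefficient of index n; on the circle z ^ (- n) is exp(-int). *)
Definition fourier f (n : int) : C := circle_int (fun z => f z * z ^ (- n)).

(* Boundary functions of the Hardy space of the disc.  The analytic function
   with boundary function f has Taylor coefficients fourier f n (n >= 0). *)
Definition H2 f : Prop := L2 f /\ forall n : int, n < 0 -> fourier f n = 0.

(* f(0), the value at the origin of the analytic extension of f. *)
Definition at0 f : C := fourier f 0.

Definition inner_function f : Prop :=
  H2 f /\ {ae mu, forall t, angles t -> Normc.normc (f (cis t)) = 1}.

Definition zH2 : set (C -> C) :=
  [set f | L2 f /\ exists2 h, H2 h & circle_ae f (fun z => z * h z)].

Definition conjH20 : set (C -> C) :=
  [set f | L2 f /\ exists h, [/\ H2 h, at0 h = 0 &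
                               circle_ae f (fun z => (h z)^*%C)]].

Definition model_space (I : C -> C) : set (C -> C) :=
  [set f | H2 f /\ exists2 h, conjH20 h & circle_ae f (fun z => I z * h z)].

(* conj(H^2_0) + theta X *)
Definition conjH20_plus (theta : C -> C) (X : set (C -> C)) : set (C -> C) :=
  [set f | L2 f /\ exists v h, [/\ conjH20 v, X h &
                               circle_ae f (fun z => v z + theta z * h z)]].

Definition Kperp (theta : C -> C) : set (C -> C) :=
  conjH20_plus theta [set h | H2 h].

(* v represents the orthogonal projection of u onto the subspace X of L^2. *)
Definition is_orth_proj (X : set (C -> C)) (u v : C -> C) : Prop :=
  X v /\ forall w, X w -> inner (fun z => u z - v z) w = 0.

(* v represents D_g^theta f; the operator is given by its graph, since its
   values are only determined almost everywhere. *)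
Definition dual_TTO (theta g f v : C -> C) : Prop :=
  Kperp theta f /\ is_orth_proj (Kperp theta) (fun z => g z * f z) v.

Definition ker_dual_TTO (theta g : C -> C) : set (C -> C) :=
  [set f | dual_TTO theta g f (fun=> 0)].

Definition mul_set (g : C -> C) (X : set (C -> C)) : set (C -> C) :=
  (fun f z => g z * f z) @` X.

Definition orth_diff (X Y : set (C -> C)) : set (C -> C) :=
  [set f | X f /\ forall h, Y h -> inner f h = 0].

(* Equality of two sets of functions, as sets of almost everywhere classes. *)
Definition same_classes (X Y : set (C -> C)) : Prop :=
  (forall f, X f -> exists2 h, Y h & circle_ae f h) /\
  (forall h, Y h -> exists2 f, X f & circle_ae f h).

Definition is_basis (X : set (C -> C)) (n : nat) (e : 'I_n -> C -> C) : Prop :=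
  [/\ forall i, X (e i),
      forall f, X f ->
        exists c : 'I_n -> C, circle_ae f (fun z => \sum_i c i * e i z) &
      forall c : 'I_n -> C, circle_ae (fun z => \sum_i c i * e i z) (fun=> 0) ->
        forall i, c i = 0].

Definition has_dim (X : set (C -> C)) (n : nat) : Prop :=
  exists e : 'I_n -> C -> C, is_basis X e.

Definition finite_dim (X : set (C -> C)) : Prop := exists n, has_dim X n.

Definition is_orthonormal (n : nat) (e : 'I_n -> C -> C) : Prop :=
  forall i j, inner (e i) (e j) = (i == j)%:R.

Definition backward_shift f : C -> C := fun z => (f z - at0 f) / z.

(* H^2(D, C^2), a column vector being the pair of its entries. *)
Definition H2v (k : (C -> C) * (C -> C)) : Prop := H2 k.1 /\ H2 k.2.

Definition normH2v_sq (k : (C -> C) * (C -> C)) : R :=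
  normL2 k.1 ^+ 2 + normL2 k.2 ^+ 2.

(* Closedness for constant sequences makes K stable under a.e. equality. *)
Definition closed_subspace_H2v (K : set ((C -> C) * (C -> C))) : Prop :=
  [/\ K `<=` [set k | H2v k],
      K (fun=> 0, fun=> 0),
      forall (a : C) k l, K k -> K l ->
        K (fun z => a * k.1 z + l.1 z, fun z => a * k.2 z + l.2 z) &
      forall (k_ : nat -> (C -> C) * (C -> C)) l, (forall n, K (k_ n)) ->
        H2v l ->
        (fun n => normH2v_sq (fun z => (k_ n).1 z - l.1 z,
                              fun z => (k_ n).2 z - l.2 z)) @ \oo --> (0 : R) ->
        K l].

Definition backward_shift_invariant (K : set ((C -> C) * (C -> C))) : Prop :=
  forall k, K k -> K (backward_shift k.1, backward_shift k.2).

(* The subspaces A and C of the theorem. *)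
Definition setA_of (theta g : C -> C) : set (C -> C) :=
  [set f | ker_dual_TTO theta g f /\
     (model_space theta `&` zH2) (fun z => g z * f z)].

Definition setC_of (theta g : C -> C) : set (C -> C) :=
  ker_dual_TTO theta g `&` conjH20_plus theta zH2 `&` setA_of theta g.

End L2.

(* Main.v *)
Require Import Defs.
From mathcomp Require Import all_boot all_order all_algebra.
From mathcomp Require Import complex.
From mathcomp Require Import all_classical all_reals all_analysis.
From mathcomp Require Import measurable_realfun ring lra.

(** Write M for g ker D_g^theta, N for gC and W for the orthogonal complement of
    N in M.  All three are finite dimensional and M lies in H^2.  If c is in C
    then c / z is again in the kernel, because z maps the complement of the
    model space into itself up to constants and gc vanishes at the origin
    ([Kperp_mulX], [gC_division]).  So N is contained in zM, and an orthonormal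
    basis e of M, written as a column, satisfies
      e = D w + z A e,   A A^* + D D^* = 1,
    where w is an orthonormal basis of W ([nearly_invariant_realization]).

    The matrix 1 - zA is invertible for every z on the circle: a left null
    vector x would give an element F = x e of M with F = c z F almost everywhere
    for a unimodular constant c, so that the Fourier coefficients of F would
    vanish with those of negative index ([realization_unit]).  With
    B(z) = (1 - zA)^-1 the relation becomes e = B D w, and each element x e of M
    is the sum of the w_j k_j for the row vector of rational functions
    k = x B D ([comb_transfer]).  These rows k form the space K of the theorem;
    all its properties are read off from B.

    - K is contained in H^2.  From B = 1 + zBA the Fourier coefficients b_m of B
      satisfy b_m = b_(m-1) A for negative m.  As A is a contraction, the norms
      of the rows of b_m can only grow as m decreases, while Bessel's inequality
      bounds the sum of their squares; hence b_m = 0 for m < 0, and then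
      b_0 = 1 ([resolvent_coef_lt0], [resolvent_coef0]).
    - K is invariant under the backward shift, which sends x B D to xA B D.
    - x e and x B D have the same norm.  On the circle
      B D D^* B^* = B + B^* - 1, and the mean of the right-hand side is
      1 + 1 - 1 ([resolvent_isometry], [inner_transfer]).

    When W is one-dimensional, spanned by gf_0, expanding gf_0 itself shows that
    A is singular.  Take a unit row b with b A^* = 0.  Then chi = b B D is inner
    and chi conj(x B D) = b B x^* on the circle, which puts K inside the model
    space of z chi ([blaschke_mul_transferJ], [transfer_model_space]).
    Conversely, if f in that model space is orthogonal to K, all the Fourier
    coefficients of f conj(chi) vanish: those of positive index because f is in
    the model space, the others because b B D z^-k differs from an element of K
    by negative powers of z ([model_space_orth0]).

    Square-integrable functions with the same Fourier coefficients agree almost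
    everywhere.  This is proved directly: the multipliers that preserve the
    functions with zero coefficients form an algebra containing z and z^-1 and
    are stable under bounded pointwise limits, hence contain the indicators of
    half circles and of arcs; so all primitives of such a function vanish
    ([fourier_inj0]). *)

Set Implicit Arguments.
Unset Strict Implicit.
Unset Printing Implicit Defensive.

Import Order.TTheory GRing.Theory Num.Theory.
Import numFieldNormedType.Exports.

Local Open Scope classical_set_scope.
Local Open Scope complex_scope.
Local Open Scope ring_scope.

Local Notation Re := complex.Re.
Local Notation Im := complex.Im.

(** * Integration and the inner product on the circle *)

Section CircleL2.
Variable R : realType.
Local Notation C := R[i].
Local Notation mu := (@lebesgue_measure R).
Local Notation angles := (@angles R).
Implicit Types (f g h : C -> C) (z : C) (t : R).

Lemma Re_mulc (x y : C) : Re (x * y) = Re x * Re y - Im x * Im y.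
Proof. by case: x y => [a b] [c d]. Qed.

Lemma Im_mulc (x y : C) : Im (x * y) = Re x * Im y + Im x * Re y.
Proof. by case: x y => [a b] [c d]. Qed.

Lemma Re_addc (x y : C) : Re (x + y) = Re x + Re y.
Proof. by case: x y => [a b] [c d]. Qed.

Lemma Im_addc (x y : C) : Im (x + y) = Im x + Im y.
Proof. by case: x y => [a b] [c d]. Qed.

Lemma Re_conjc (x : C) : Re x^*%C = Re x.
Proof. by case: x. Qed.

Lemma Im_conjc (x : C) : Im x^*%C = - Im x.
Proof. by case: x. Qed.

Lemma conjcD (x y : C) : (x + y)^*%C = x^*%C + y^*%C.
Proof. exact: rmorphD. Qed.

Lemma conjcM (x y : C) : (x * y)^*%C = x^*%C * y^*%C.
Proof. exact: rmorphM. Qed.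

Lemma conjc_sum (I : Type) (r : seq I) (F : I -> C) :
  (\sum_(i <- r) F i)^*%C = \sum_(i <- r) (F i)^*%C.
Proof. exact: rmorph_sum. Qed.

Lemma sqr_normcE (x : C) : Normc.normc x ^+ 2 = Re x ^+ 2 + Im x ^+ 2.
Proof. by case: x => a b /=; rewrite sqr_sqrtr // addr_ge0 ?sqr_ge0. Qed.

Lemma normc_nneg (x : C) : 0 <= Normc.normc x.
Proof. by case: x => a b /=; exact: sqrtr_ge0. Qed.

Lemma mulc_conjc (x : C) : x * x^*%C = (Normc.normc x ^+ 2)%:C.
Proof.
rewrite sqr_normcE; case: x => a b; apply/eqP; rewrite eq_complex /=.
by apply/andP; split; apply/eqP; ring.
Qed.

Lemma abs_Re_le (x : C) : `|Re x| <= Normc.normc x.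
Proof. by case: x => a b /=; rewrite -sqrtr_sqr ler_wsqrtr// lerDl sqr_ge0. Qed.

Lemma abs_Im_le (x : C) : `|Im x| <= Normc.normc x.
Proof. by case: x => a b /=; rewrite -sqrtr_sqr ler_wsqrtr// lerDr sqr_ge0. Qed.

Lemma normc_conjc (x : C) : Normc.normc x^*%C = Normc.normc x.
Proof. by case: x => a b /=; rewrite sqrrN. Qed.

Lemma cis_mulJ t : cis t * (cis t)^*%C = 1.
Proof. by rewrite mulc_conjc sqr_normcE /= cos2Dsin2. Qed.

Lemma circle_neq0 z : z * z^*%C = 1 -> z != 0.
Proof. by apply: contra_eqN => /eqP ->; rewrite mul0r eq_sym oner_eq0. Qed.

Lemma circle_inv z : z * z^*%C = 1 -> z^-1 = z^*%C.
Proof.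
by move=> z1; apply: (mulfI (circle_neq0 z1)); rewrite z1 divff// circle_neq0.
Qed.

(** The filter is passed explicitly because almost-everywhere statements arise
    with measurable structures that are convertible but not syntactically
    equal. *)
Lemma ae_angles1 (P Q : R -> Prop) : (forall t, angles t -> P t -> Q t) ->
  {ae mu, forall t, angles t -> P t} -> {ae mu, forall t, angles t -> Q t}.
Proof.
move=> h; apply: (@filterS _ _ (ae_filter_ringOfSetsType mu)) => t + ht.
by move=> /(_ ht); exact: h.
Qed.

Lemma ae_angles2 (P Q S : R -> Prop) :
  (forall t, angles t -> P t -> Q t -> S t) ->
  {ae mu, forall t, angles t -> P t} -> {ae mu, forall t, angles t -> Q t} ->
  {ae mu, forall t, angles t -> S t}.
Proof.
move=> h; apply: (@filterS2 _ _ (ae_filter_ringOfSetsType mu)) => t + + ht.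
by move=> /(_ ht) + /(_ ht); exact: h.
Qed.

(** The equation z * z^* = 1 stands for membership in the circle, so algebraic
    identities can be proved without mentioning angles. *)
Lemma circle_ae1 (f g f' g' : C -> C) :
  (forall z, z * z^*%C = 1 -> f z = g z -> f' z = g' z) ->
  circle_ae f g -> circle_ae f' g'.
Proof.
by move=> h; apply: ae_angles1 => t _; apply: h; exact: cis_mulJ.
Qed.

Lemma circle_ae2 (f g f' g' f'' g'' : C -> C) :
  (forall z, z * z^*%C = 1 -> f z = g z -> f' z = g' z -> f'' z = g'' z) ->
  circle_ae f g -> circle_ae f' g' -> circle_ae f'' g''.
Proof.
by move=> h; apply: ae_angles2 => t _; apply: h; exact: cis_mulJ.
Qed.

Lemma circle_ae_pointwise f g : (forall z, z * z^*%C = 1 -> f z = g z) -> circle_ae f g.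
Proof. by move=> h; apply: aeW => t _ /=; apply: h; exact: cis_mulJ. Qed.

Lemma circle_ae_refl f : circle_ae f f.
Proof. exact: circle_ae_pointwise. Qed.

Lemma circle_ae_sym f g : circle_ae f g -> circle_ae g f.
Proof. by apply: circle_ae1. Qed.

Lemma circle_ae_trans g f h : circle_ae f g -> circle_ae g h -> circle_ae f h.
Proof. by apply: circle_ae2 => z _ -> ->. Qed.

Lemma circle_ae_sum (I : Type) (r : seq I) (F G : I -> C -> C) :
  (forall i, circle_ae (F i) (G i)) ->
  circle_ae (fun z => \sum_(i <- r) F i z) (fun z => \sum_(i <- r) G i z).
Proof.
move=> FG; elim: r => [|i r IH].
  by apply: circle_ae_pointwise => z _; rewrite !big_nil.
by apply: circle_ae2 (FG i) IH => z _ E1 E2; rewrite !big_cons E1 E2.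
Qed.

Lemma measurable_angles : measurable angles.
Proof. exact: measurable_itv. Qed.
Hint Resolve measurable_angles : core.

Lemma pi2_gt0 : 0 < 2 * pi :> R.
Proof. by rewrite mulr_gt0// pi_gt0. Qed.

Lemma mu_angles : mu angles = (2 * pi)%:E.
Proof. by rewrite lebesgue_measure_itv /= lte_fin pi2_gt0 sube0. Qed.

Lemma mu_angles_fin : (mu angles < +oo)%E.
Proof. by rewrite mu_angles ltry. Qed.

Local Notation integrable u := (mu.-integrable angles (EFin \o u)).

Lemma integrable_addr (u v : R -> R) : integrable u -> integrable v ->
  integrable (fun t => u t + v t).
Proof. by move=> iu iv; apply: (integrableD _ iu iv); exact: measurable_itv. Qed.

Lemma integrable_mulrl (a : R) (u : R -> R) : integrable u ->
  integrable (fun t => a * u t).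
Proof. by move=> iu; apply: (integrableZl _ a iu); exact: measurable_itv. Qed.

Lemma ae_le_integrable (u v : R -> R) :
  measurable_fun angles u -> {ae mu, forall t, angles t -> `|u t| <= v t} ->
  mu.-integrable angles (EFin \o v) -> mu.-integrable angles (EFin \o u).
Proof.
move=> mfu uv /integrableP[mv iv]; apply/integrableP; split.
  exact/measurable_EFinP.
apply: le_lt_trans iv; apply: ae_ge0_le_integral => //.
- by apply: measurableT_comp => //; exact/measurable_EFinP.
- by apply: measurableT_comp => //.
- apply: ae_angles1 uv => t _ h /=.
  by rewrite lee_fin (le_trans h)// ler_norm.
Qed.

Lemma circle_measurableD f g : circle_measurable f -> circle_measurable g ->
  circle_measurable (fun z => f z + g z).
Proof.
move=> [f1 f2] [g1 g2]; split.
  by under eq_fun do rewrite Re_addc; exact: measurable_funD.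
by under eq_fun do rewrite Im_addc; exact: measurable_funD.
Qed.

Lemma circle_measurableM f g : circle_measurable f -> circle_measurable g ->
  circle_measurable (fun z => f z * g z).
Proof.
move=> [f1 f2] [g1 g2]; split.
  by under eq_fun do rewrite Re_mulc; apply: measurable_funB; exact: measurable_funM.
by under eq_fun do rewrite Im_mulc; apply: measurable_funD; exact: measurable_funM.
Qed.

Lemma circle_measurableJ f :
  circle_measurable f -> circle_measurable (fun z => (f z)^*%C).
Proof.
move=> [f1 f2]; split; first by under eq_fun do rewrite Re_conjc.
by under eq_fun do rewrite Im_conjc; exact: measurableT_comp.
Qed.

(** Continuity along the parametrisation by angles: it gives both measurability
    and boundedness, and is stable under all field operations. *)
Definition circle_continuous f : Prop :=
  continuous (fun t => Re (f (cis t))) /\ continuous (fun t => Im (f (cis t))).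

Lemma circle_continuous_cst (a : C) : circle_continuous (fun=> a).
Proof. by split; exact: cst_continuous. Qed.

Lemma circle_continuous_id : circle_continuous (fun z => z).
Proof. by split; [exact: continuous_cos|exact: continuous_sin]. Qed.

Lemma circle_continuousD f g : circle_continuous f -> circle_continuous g ->
  circle_continuous (fun z => f z + g z).
Proof.
move=> [f1 f2] [g1 g2]; split.
  by under eq_fun do rewrite Re_addc; move=> t; apply: cvgD; [exact: f1|exact: g1].
by under eq_fun do rewrite Im_addc; move=> t; apply: cvgD; [exact: f2|exact: g2].
Qed.

Lemma circle_continuousM f g : circle_continuous f -> circle_continuous g ->
  circle_continuous (fun z => f z * g z).
Proof.
move=> [f1 f2] [g1 g2]; split.
  under eq_fun do rewrite Re_mulc; move=> t.
  by apply: cvgB; apply: cvgM; [exact: f1|exact: g1|exact: f2|exact: g2].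
under eq_fun do rewrite Im_mulc; move=> t.
by apply: cvgD; apply: cvgM; [exact: f1|exact: g2|exact: f2|exact: g1].
Qed.

Lemma circle_continuousV f : circle_continuous f ->
  (forall z, z * z^*%C = 1 -> f z != 0) -> circle_continuous (fun z => (f z)^-1).
Proof.
move=> [f1 f2] f0.
have n0 t : Re (f (cis t)) ^+ 2 + Im (f (cis t)) ^+ 2 != 0.
  rewrite paddr_eq0 ?sqr_ge0// !sqrf_eq0; apply/negP => /andP[/eqP a /eqP b].
  by have := f0 _ (cis_mulJ t); rewrite eq_complex /= a b !eqxx.
have ReV (x : C) : Re x^-1 = Re x * (Re x ^+ 2 + Im x ^+ 2)^-1 by case: x.
have ImV (x : C) : Im x^-1 = - (Im x * (Re x ^+ 2 + Im x ^+ 2)^-1) by case: x.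
have cV : continuous (fun t => (Re (f (cis t)) ^+ 2 + Im (f (cis t)) ^+ 2)^-1).
  move=> t; apply: cvgV; first exact: n0.
  by apply: cvgD; under eq_fun do rewrite expr2; apply: cvgM;
    [exact: f1|exact: f1|exact: f2|exact: f2].
split.
  by under eq_fun do rewrite ReV; move=> t; apply: cvgM; [exact: f1|exact: cV].
under eq_fun do rewrite ImV; move=> t; apply: cvgN.
by apply: cvgM; [exact: f2|exact: cV].
Qed.

Lemma circle_continuous_sum (I : Type) (r : seq I) (F : I -> C -> C) :
  (forall i, circle_continuous (F i)) ->
  circle_continuous (fun z => \sum_(i <- r) F i z).
Proof.
move=> cF; elim: r => [|i r IH].
  by under eq_fun do rewrite big_nil; exact: circle_continuous_cst.
by under eq_fun do rewrite big_cons; exact: circle_continuousD.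
Qed.

Lemma circle_continuous_prod (I : Type) (r : seq I) (F : I -> C -> C) :
  (forall i, circle_continuous (F i)) ->
  circle_continuous (fun z => \prod_(i <- r) F i z).
Proof.
move=> cF; elim: r => [|i r IH].
  by under eq_fun do rewrite big_nil; exact: circle_continuous_cst.
by under eq_fun do rewrite big_cons; exact: circle_continuousM.
Qed.

Lemma circle_continuous_ext f g : (forall z, z * z^*%C = 1 -> f z = g z) ->
  circle_continuous f -> circle_continuous g.
Proof.
move=> fg [f1 f2]; have E (t : R) : g (cis t) = f (cis t) by rewrite fg ?cis_mulJ.
by split; under eq_fun do rewrite E.
Qed.

Lemma circle_continuous_Linfty f : circle_continuous f -> Linfty f.
Proof.
move=> [f1 f2]; split.
  by split; apply: (@measurable_funS _ _ _ _ setT) => //;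
    exact: continuous_measurable_fun.
have pi0 : 0 <= 2 * pi :> R by exact/ltW/pi2_gt0.
have cn : continuous (fun t => Re (f (cis t)) ^+ 2 + Im (f (cis t)) ^+ 2).
  move=> t; apply: cvgD; under eq_fun do rewrite expr2; apply: cvgM;
    by [exact: f1|exact: f1|exact: f2|exact: f2].
have [c _ hc] := EVT_max pi0 (continuous_subspaceT cn).
exists (Normc.normc (f (cis c))); apply: aeW => t ht.
rewrite -(ler_pXn2r (n := 2)) ?nnegrE ?normc_nneg// !sqr_normcE.
exact: hc.
Qed.

Lemma LinftyM f g : Linfty f -> Linfty g -> Linfty (fun z => f z * g z).
Proof.
move=> [mf [M hM]] [mg [N hN]]; split; first exact: circle_measurableM.
exists (M * N); apply: ae_angles2 hM hN => t _ a b.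
by rewrite Normc.normcM ler_pM ?normc_nneg.
Qed.

Lemma LinftyD f g : Linfty f -> Linfty g -> Linfty (fun z => f z + g z).
Proof.
move=> [mf [M hM]] [mg [N hN]]; split; first exact: circle_measurableD.
exists (M + N); apply: ae_angles2 hM hN => t _ a b.
by rewrite (le_trans (le_normcD _ _))// lerD.
Qed.

Lemma LinftyJ f : Linfty f -> Linfty (fun z => (f z)^*%C).
Proof.
move=> [mf [M hM]]; split; first exact: circle_measurableJ.
by exists M; apply: ae_angles1 hM => t _; rewrite normc_conjc.
Qed.

Lemma L2P f : L2 f <-> circle_measurable f /\
  mu.-integrable angles (EFin \o (fun t => Normc.normc (f (cis t)) ^+ 2)).
Proof.
rewrite /L2; split=> -[mf h]; split => //; last first.
  by apply: integrable_lty h.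
apply/integrableP; split.
  apply/measurable_EFinP; under eq_fun do rewrite sqr_normcE.
  by case: mf => f1 f2; apply: measurable_funD; exact: measurable_funX.
apply: le_lt_trans h; rewrite le_eqVlt; apply/orP; left; apply/eqP.
by apply: eq_integral => t _ /=; rewrite ger0_norm// sqr_ge0.
Qed.

Lemma L2_measurable f : L2 f -> circle_measurable f.
Proof. by case. Qed.

Lemma L2_dominated f (v : R -> R) : circle_measurable f ->
  {ae mu, forall t, angles t -> Normc.normc (f (cis t)) ^+ 2 <= v t} ->
  mu.-integrable angles (EFin \o v) -> L2 f.
Proof.
move=> mf fv iv; apply/L2P; split => //; apply: ae_le_integrable iv.
  under eq_fun do rewrite sqr_normcE.
  by case: mf => f1 f2; apply: measurable_funD; exact: measurable_funX.
by apply: ae_angles1 fv => t _; rewrite ger0_norm ?sqr_ge0.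
Qed.

Lemma L2D f g : L2 f -> L2 g -> L2 (fun z => f z + g z).
Proof.
move=> /L2P[mf fi] /L2P[mg gi].
apply: (@L2_dominated _ (fun t => 2 * Normc.normc (f (cis t)) ^+ 2 +
                                  2 * Normc.normc (g (cis t)) ^+ 2)).
- exact: circle_measurableD.
- apply: aeW => t _; rewrite !sqr_normcE Re_addc Im_addc.
  set a := Re _; set b := Re _; set c := Im _; set d := Im _.
  have := sqr_ge0 (a - b); have := sqr_ge0 (c - d); nra.
- by apply: integrable_addr; apply: integrable_mulrl.
Qed.

Lemma L2M f g : Linfty f -> L2 g -> L2 (fun z => f z * g z).
Proof.
move=> [mf [M hM]] /L2P[mg gi].
apply: (@L2_dominated _ (fun t => M ^+ 2 * Normc.normc (g (cis t)) ^+ 2)).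
- exact: circle_measurableM.
- apply: ae_angles1 hM => t _ h; rewrite Normc.normcM exprMn.
  by rewrite ler_wpM2r ?sqr_ge0// lerXn2r ?nnegrE ?normc_nneg// (le_trans _ h)// normc_nneg.
- exact: integrable_mulrl.
Qed.

Lemma L2Z (a : C) f : L2 f -> L2 (fun z => a * f z).
Proof. exact/L2M/circle_continuous_Linfty/circle_continuous_cst. Qed.

Lemma L2N f : L2 f -> L2 (fun z => - f z).
Proof. by move=> /(L2Z (-1)); under eq_fun do rewrite mulN1r. Qed.

Lemma L2B f g : L2 f -> L2 g -> L2 (fun z => f z - g z).
Proof. by move=> hf hg; apply: L2D => //; exact: L2N. Qed.

Lemma L2J f : L2 f -> L2 (fun z => (f z)^*%C).
Proof.
move=> [mf fi]; split; first exact: circle_measurableJ.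
by under eq_integral do rewrite normc_conjc.
Qed.

Lemma L2_cst (a : C) : L2 (fun=> a).
Proof.
apply: (@L2_dominated _ (cst (Normc.normc a ^+ 2))).
- exact: (circle_continuous_Linfty (circle_continuous_cst a)).1.
- exact: aeW.
- apply: measurable_bounded_integrable => //; first exact: mu_angles_fin.
  exact: bounded_cst.
Qed.

Lemma Linfty_L2 f : Linfty f -> L2 f.
Proof.
by move=> /L2M/(_ (L2_cst 1)); under eq_fun do rewrite mulr1.
Qed.

Lemma circle_continuous_L2 f : circle_continuous f -> L2 f.
Proof. by move=> /circle_continuous_Linfty/Linfty_L2. Qed.

Lemma L2_sum (I : Type) (r : seq I) (F : I -> C -> C) : (forall i, L2 (F i)) ->
  L2 (fun z => \sum_(i <- r) F i z).
Proof.
move=> cF; elim: r => [|i r IH].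
  by under eq_fun do rewrite big_nil; exact: L2_cst.
by under eq_fun do rewrite big_cons; exact: L2D.
Qed.

(** Linearity of [circle_int] needs integrability of both components. *)
Definition circle_integrable f : Prop :=
  mu.-integrable angles (EFin \o (fun t => Re (f (cis t)))) /\
  mu.-integrable angles (EFin \o (fun t => Im (f (cis t)))).

Lemma circle_integrableD f g : circle_integrable f -> circle_integrable g ->
  circle_integrable (fun z => f z + g z).
Proof.
move=> [f1 f2] [g1 g2]; split.
  by under eq_fun do rewrite Re_addc; exact: integrable_addr.
by under eq_fun do rewrite Im_addc; exact: integrable_addr.
Qed.

Lemma circle_intD f g : circle_integrable f -> circle_integrable g ->
  circle_int (fun z => f z + g z) = circle_int f + circle_int g.
Proof.
move=> [f1 f2] [g1 g2]; apply/eqP; rewrite eq_complex /=; apply/andP; split.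
  under eq_Rintegral do rewrite Re_addc.
  by rewrite RintegralD// mulrDr.
under eq_Rintegral do rewrite Im_addc.
by rewrite RintegralD// mulrDr.
Qed.

Lemma circle_intZ (a : C) f : circle_integrable f ->
  circle_int (fun z => a * f z) = a * circle_int f.
Proof.
move=> [f1 f2]; apply/eqP; rewrite eq_complex /= ?Re_mulc ?Im_mulc; apply/andP; split.
  under eq_Rintegral do rewrite Re_mulc.
  rewrite RintegralB//; [|exact: integrable_mulrl..].
  by rewrite !RintegralZl//; case: a => a b /=; apply/eqP; ring.
under eq_Rintegral do rewrite Im_mulc.
rewrite RintegralD//; [|exact: integrable_mulrl..].
by rewrite !RintegralZl//; case: a => a b /=; apply/eqP; ring.
Qed.

Lemma circle_intJ f : circle_integrable f ->
  circle_int (fun z => (f z)^*%C) = (circle_int f)^*%C.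
Proof.
move=> [f1 f2]; apply/eqP; rewrite eq_complex /=; apply/andP; split.
  by under eq_Rintegral do rewrite Re_conjc.
under eq_Rintegral do rewrite Im_conjc -mulN1r.
by rewrite RintegralZl// mulN1r mulrN.
Qed.

Lemma circle_int_ae f g : circle_measurable f -> circle_measurable g ->
  circle_ae f g -> circle_int f = circle_int g.
Proof.
move=> [f1 f2] [g1 g2] fg; congr (_ * fine _ +i* (_ * fine _)).
- apply: ae_eq_integral => //; try exact/measurable_EFinP.
  by apply: ae_angles1 fg => t _ /= ->.
- apply: ae_eq_integral => //; try exact/measurable_EFinP.
  by apply: ae_angles1 fg => t _ /= ->.
Qed.

Lemma eq_circle_int f g : (forall z, z * z^*%C = 1 -> f z = g z) ->
  circle_int f = circle_int g.
Proof.
by move=> fg; congr (_ * _ +i* (_ * _)); apply: eq_Rintegral => t _;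
  rewrite fg// cis_mulJ.
Qed.

Lemma circle_int_cst (a : C) : circle_int (fun=> a) = a.
Proof.
have E (r : R) : \int[mu]_(_ in angles) r = r * (2 * pi).
  transitivity (r * fine (2 * pi)%:E) => //.
  by rewrite Rintegral_cst//; congr (_ * fine _); exact: mu_angles.
rewrite /circle_int !E.
by rewrite ![(2 * pi)^-1 * _]mulrC !mulfK ?(gt_eqF pi2_gt0)//; case: a.
Qed.

Lemma L2_integrableM f g : L2 f -> L2 g -> circle_integrable (fun z => f z * g z).
Proof.
move=> /L2P[mf fi] /L2P[mg gi].
have [m1 m2] := circle_measurableM mf mg.
have key t : Normc.normc (f (cis t) * g (cis t)) <=
    Normc.normc (f (cis t)) ^+ 2 + Normc.normc (g (cis t)) ^+ 2.
  rewrite Normc.normcM; set a := Normc.normc _; set b := Normc.normc _.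
  have := sqr_ge0 (a - b); have := sqr_ge0 (a + b); nra.
have ki := integrable_addr fi gi.
split; apply: (ae_le_integrable _ _ ki) => //; apply: aeW => t _.
  exact: le_trans (abs_Re_le _) (key t).
exact: le_trans (abs_Im_le _) (key t).
Qed.

Lemma L2_integrable f : L2 f -> circle_integrable f.
Proof.
by move=> /L2_integrableM/(_ (L2_cst 1)); under eq_fun do rewrite mulr1.
Qed.

Lemma circle_int_sum (I : Type) (r : seq I) (F : I -> C -> C) :
  (forall i, L2 (F i)) -> circle_int (fun z => \sum_(i <- r) F i z) = \sum_(i <- r) circle_int (F i).
Proof.
move=> iF; elim: r => [|i r IH].
  by rewrite big_nil -[RHS](circle_int_cst 0); apply: eq_circle_int => z _; rewrite big_nil.
rewrite big_cons -IH -circle_intD; [|exact: L2_integrable|exact/L2_integrable/L2_sum].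
by apply: eq_circle_int => z _; rewrite big_cons.
Qed.

Lemma inner_integrable f g : L2 f -> L2 g ->
  circle_integrable (fun z => f z * (g z)^*%C).
Proof. by move=> hf /L2J; exact: L2_integrableM. Qed.

Lemma innerDl f g h : L2 f -> L2 g -> L2 h ->
  inner (fun z => f z + g z) h = inner f h + inner g h.
Proof.
move=> hf hg hh; rewrite /inner -circle_intD; [|exact: inner_integrable..].
by apply: eq_circle_int => z _; rewrite mulrDl.
Qed.

Lemma innerZl (a : C) f h : L2 f -> L2 h ->
  inner (fun z => a * f z) h = a * inner f h.
Proof.
move=> hf hh; rewrite /inner -circle_intZ; [|exact: inner_integrable].
by apply: eq_circle_int => z _; rewrite mulrA.
Qed.

Lemma innerC f g : L2 f -> L2 g -> inner f g = (inner g f)^*%C.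
Proof.
move=> hf hg; rewrite /inner -circle_intJ; [|exact: inner_integrable].
by apply: eq_circle_int => z _; rewrite conjcM conjcK mulrC.
Qed.

Lemma innerDr f g h : L2 f -> L2 g -> L2 h ->
  inner h (fun z => f z + g z) = inner h f + inner h g.
Proof.
move=> hf hg hh; rewrite innerC//; last exact: L2D.
by rewrite innerDl// conjcD -!innerC.
Qed.

Lemma innerZr (a : C) f h : L2 f -> L2 h ->
  inner h (fun z => a * f z) = a^*%C * inner h f.
Proof.
move=> hf hh; rewrite innerC//; last exact: L2Z.
by rewrite innerZl// conjcM -innerC.
Qed.

Lemma innerNl f h : L2 f -> L2 h -> inner (fun z => - f z) h = - inner f h.
Proof.
move=> hf hh; rewrite -mulN1r -innerZl//.
by apply: eq_circle_int => z _; rewrite mulN1r.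
Qed.

Lemma innerBl f g h : L2 f -> L2 g -> L2 h ->
  inner (fun z => f z - g z) h = inner f h - inner g h.
Proof. by move=> hf hg hh; rewrite innerDl ?innerNl//; exact: L2N. Qed.

Lemma inner_suml (I : Type) (r : seq I) (c : I -> C) (F : I -> C -> C) h :
  (forall i, L2 (F i)) -> L2 h ->
  inner (fun z => \sum_(i <- r) c i * F i z) h = \sum_(i <- r) c i * inner (F i) h.
Proof.
move=> hF hh; elim: r => [|i r IH].
  rewrite big_nil -[0 in RHS](mul0r (inner h h)) -innerZl//.
  by apply: eq_circle_int => z _; rewrite big_nil mul0r.
rewrite big_cons -IH -innerZl// -innerDl//; [|exact: L2Z|].
  by apply: eq_circle_int => z _; rewrite big_cons.
by apply: L2_sum => j; exact: L2Z.
Qed.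

Lemma inner_sumr (I : Type) (r : seq I) (c : I -> C) (F : I -> C -> C) h :
  (forall i, L2 (F i)) -> L2 h ->
  inner h (fun z => \sum_(i <- r) c i * F i z) =
  \sum_(i <- r) (c i)^*%C * inner h (F i).
Proof.
move=> hF hh; rewrite innerC//; last by apply: L2_sum => i; exact: L2Z.
rewrite inner_suml// conjc_sum; apply: eq_bigr => i _.
by rewrite conjcM -innerC.
Qed.

Lemma inner0l h : inner (fun=> 0) h = 0.
Proof. by rewrite -[RHS](circle_int_cst 0); apply: eq_circle_int => z _; rewrite mul0r. Qed.

Lemma inner_ae f f' g g' : L2 f -> L2 f' -> L2 g -> L2 g' ->
  circle_ae f f' -> circle_ae g g' -> inner f g = inner f' g'.
Proof.
move=> hf hf' hg hg' ff gg; apply: circle_int_ae.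
- by apply: circle_measurableM; [|apply: circle_measurableJ]; exact: L2_measurable.
- by apply: circle_measurableM; [|apply: circle_measurableJ]; exact: L2_measurable.
- by apply: circle_ae2 ff gg => z _ -> ->.
Qed.

Lemma inner_self f : inner f f = (Re (inner f f))%:C.
Proof.
apply/eqP; rewrite eq_complex /= eqxx /=; apply/eqP.
under eq_Rintegral => t _ do rewrite mulc_conjc /=.
by rewrite Rintegral_cst// mul0r mulr0.
Qed.

Lemma inner_self_ge0 f : 0 <= Re (inner f f).
Proof.
rewrite /inner /= mulr_ge0 ?invr_ge0 ?(ltW pi2_gt0)//.
by apply: Rintegral_ge0 => t _; rewrite mulc_conjc sqr_ge0.
Qed.

Lemma normL2_sq f : normL2 f ^+ 2 = Re (inner f f).
Proof. by rewrite sqr_sqrtr// inner_self_ge0. Qed.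

Lemma inner_selfE f : inner f f = (normL2 f ^+ 2)%:C.
Proof. by rewrite normL2_sq -inner_self. Qed.

Lemma normL2_sq_ae f g : L2 f -> L2 g -> circle_ae f g ->
  normL2 f ^+ 2 = normL2 g ^+ 2.
Proof. by move=> hf hg fg; rewrite !normL2_sq (inner_ae hf hg hf hg). Qed.

Lemma inner_eq0 f : L2 f -> inner f f = 0 -> circle_ae f (fun=> 0).
Proof.
move=> /L2P[[m1 m2] fi] /(congr1 (@Re R)) /= /eqP.
rewrite mulf_eq0 invr_eq0 (gt_eqF pi2_gt0) /= => /eqP int0.
pose n t : \bar R := (Normc.normc (f (cis t)) ^+ 2)%:E.
have mn : measurable_fun angles n by exact: measurable_int fi.
have n0 : (\int[mu]_(t in angles) n t = 0)%E.
  have nfin : (\int[mu]_(t in angles) n t)%E \is a fin_num.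
    by apply: integrable_fin_num fi.
  rewrite -(fineK nfin); congr EFin; rewrite -[RHS]int0; congr fine.
  by apply: eq_integral => t _; rewrite mulc_conjc.
have /(ae_eq_integral_abs mu _ mn) : (\int[mu]_(t in angles) `|n t| = 0)%E.
  by rewrite -n0; apply: eq_integral => t _; rewrite gee0_abs// lee_fin sqr_ge0.
move=> /(_ (measurable_itv _)); apply: ae_angles1 => t _ /= [] /eqP.
by rewrite sqrf_eq0 => /eqP/Normc.eq0_normc.
Qed.

End CircleL2.

(** * Fourier coefficients and Hardy spaces *)

Section Fourier.
Variable R : realType.
Local Notation C := R[i].
Local Notation mu := (@lebesgue_measure R).
Local Notation angles := (@angles R).
Implicit Types (f g h : C -> C) (z : C) (n m : int).

Lemma circle_exp1 z n : z * z^*%C = 1 -> z ^ n * (z ^ n)^*%C = 1.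
Proof.
move=> z1; have pos (k : nat) : z ^+ k * (z ^+ k)^*%C = 1.
  elim: k => [|k IH]; first by rewrite expr0 conjc1 mulr1.
  by rewrite exprS conjcM mulrACA z1 mul1r.
case: n => k; first exact: pos.
by rewrite /exprz /= conjc_inv -invfM pos invr1.
Qed.

Lemma circle_expJ z n : z * z^*%C = 1 -> z ^ (- n) = (z ^ n)^*%C.
Proof. by move=> z1; rewrite -invr_expz (circle_inv (circle_exp1 n z1)). Qed.

Lemma circle_continuous_exp n : circle_continuous (fun z : C => z ^ n).
Proof.
have pos (k : nat) : circle_continuous (fun z : C => z ^+ k).
  elim: k => [|k IH]; first exact: circle_continuous_cst.
  under eq_fun do rewrite exprS.
  by apply: circle_continuousM => //; exact: circle_continuous_id.
case: n => k; first exact: pos.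
apply: circle_continuousV (pos k.+1) _ => z /circle_neq0 z0.
by rewrite expf_neq0.
Qed.

Lemma L2_exp n : L2 (fun z : C => z ^ n).
Proof. exact/circle_continuous_L2/circle_continuous_exp. Qed.

Lemma L2_expM n f : L2 f -> L2 (fun z => z ^ n * f z).
Proof. exact/L2M/circle_continuous_Linfty/circle_continuous_exp. Qed.

(** Coefficients are inner products with characters, so linearity and invariance
    under almost-everywhere equality are inherited from [inner]. *)
Lemma fourierE f n : fourier f n = inner f (fun z => z ^ n).
Proof. by apply: eq_circle_int => z z1; rewrite circle_expJ. Qed.

Lemma fourier_ae f g n : L2 f -> L2 g -> circle_ae f g -> fourier f n = fourier g n.
Proof.
move=> hf hg fg; rewrite !fourierE; apply: inner_ae => //; try exact: L2_exp.
exact: circle_ae_refl.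
Qed.

Lemma fourierD f g n : L2 f -> L2 g ->
  fourier (fun z => f z + g z) n = fourier f n + fourier g n.
Proof. by move=> hf hg; rewrite !fourierE innerDl//; exact: L2_exp. Qed.

Lemma fourierB f g n : L2 f -> L2 g ->
  fourier (fun z => f z - g z) n = fourier f n - fourier g n.
Proof. by move=> hf hg; rewrite !fourierE innerBl//; exact: L2_exp. Qed.

Lemma fourierZ (a : C) f n : L2 f ->
  fourier (fun z => a * f z) n = a * fourier f n.
Proof. by move=> hf; rewrite !fourierE innerZl//; exact: L2_exp. Qed.

Lemma fourier_sum (I : Type) (r : seq I) (c : I -> C) (F : I -> C -> C) n :
  (forall i, L2 (F i)) ->
  fourier (fun z => \sum_(i <- r) c i * F i z) n = \sum_(i <- r) c i * fourier (F i) n.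
Proof.
move=> hF; rewrite fourierE inner_suml//; last exact: L2_exp.
by apply: eq_bigr => i _; rewrite fourierE.
Qed.

Lemma fourier_shift k f n : fourier (fun z => z ^ k * f z) n = fourier f (n - k).
Proof.
apply: eq_circle_int => z /circle_neq0 z0.
by rewrite mulrAC mulrC -expfzDr// opprB.
Qed.

Lemma fourier_mulX f n : fourier (fun z => z * f z) n = fourier f (n - 1).
Proof. by rewrite -fourier_shift. Qed.

Lemma fourierJ f n : L2 f -> fourier (fun z => (f z)^*%C) n = (fourier f (- n))^*%C.
Proof.
move=> hf; rewrite !fourierE (innerC hf); last exact: L2_exp.
rewrite conjcK; apply: eq_circle_int => z z1.
by rewrite mulrC -circle_expJ.
Qed.

Lemma cis_exp (t : R) (k : nat) : cis t ^+ k = cis (k%:R * t).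
Proof.
elim: k => [|k IH].
  by rewrite expr0 mul0r /cis cos0 sin0.
rewrite exprS IH -natr1 mulrDl mul1r addrC /cis cosD sinD.
apply/eqP; rewrite eq_complex /=; apply/andP; split; apply/eqP => //.
by rewrite addrC.
Qed.

(** The antiderivatives of the two components of exp(ikt) are 2 pi-periodic. *)
Lemma circle_int_exp_pos (k : nat) : (0 < k)%N -> circle_int (fun z : C => z ^+ k) = 0.
Proof.
move=> k0; have k1 : k%:R != 0 :> R by rewrite pnatr_eq0 -lt0n.
have cis2pi : cis (k%:R * (2 * pi)) = 1 :> C.
  rewrite -cis_exp (_ : cis _ = 1) ?expr1n//.
  by rewrite /cis mulr_natl cos2pi sin2pi.
have [c2 s2] : cos (k%:R * (2 * pi)) = 1 :> R /\ sin (k%:R * (2 * pi)) = 0 :> R.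
  by case: cis2pi.
have lin (x : R) : is_derive x 1 (fun t : R => k%:R * t) k%:R.
  by apply: (is_derive_eq (is_deriveZ k%:R (is_derive_id x 1))); rewrite /GRing.scale /= mulr1.
have dF (F F' G : R -> R) : (forall x : R, is_derive x 1 F (F' x)) ->
    continuous F' -> (forall t, G t = k%:R^-1 * F (k%:R * t)) ->
    \int[mu]_(t in angles) F' (k%:R * t) = G (2 * pi) - G 0.
  move=> hF cF' hG.
  have dG (x : R) : is_derive x 1 G (F' (k%:R * x)).
    rewrite (funext hG); have h1 := is_derive1_comp (hF (k%:R * x)) (lin x).
    apply: (is_derive_eq (is_deriveZ k%:R^-1 h1)).
    by rewrite /GRing.scale /= mulrCA mulVf ?mulr1.
  have cG : continuous G by move=> x; apply/differentiable_continuous/derivable1_diffP; case: (dG x).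
  rewrite /Rintegral (@continuous_FTC2 _ _ G)//.
  - exact: pi2_gt0.
  - apply: continuous_subspaceT => x; apply: continuous_comp; last exact: cF'.
    by apply: cvgM; [exact: cvg_cst|exact: cvg_id].
  - split; [by move=> x _; case: (dG x)| |].
      by apply: cvg_at_right_filter; exact: cG.
    by apply: cvg_at_left_filter; exact: cG.
  - by move=> x _; rewrite derive1E; case: (dG x).
apply/eqP; rewrite eq_complex /=; apply/andP; split.
  under eq_Rintegral do rewrite cis_exp /=.
  rewrite (dF sin cos (fun t => k%:R^-1 * sin (k%:R * t)))//; last exact: continuous_cos.
  by rewrite s2 !mulr0 sin0 !mulr0 subrr mulr0.
under eq_Rintegral do rewrite cis_exp /=.
have dcos (x : R) : is_derive x 1 (fun t : R => - cos t) (sin x).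
  by apply: (is_derive_eq (is_deriveN (is_derive_cos x))); rewrite opprK.
rewrite (dF _ _ (fun t => k%:R^-1 * - cos (k%:R * t)) dcos)//; last exact: continuous_sin.
by rewrite c2 !mulr0 cos0 subrr mulr0.
Qed.

Lemma circle_int_exp n : circle_int (fun z : C => z ^ n) = (n == 0)%:R.
Proof.
case: n => [[|k]|k].
- by under eq_fun do rewrite expr0z; rewrite circle_int_cst.
- exact: circle_int_exp_pos.
- rewrite (_ : Negz k = - (k.+1%:Z))//.
  transitivity (circle_int (fun z : C => (z ^+ k.+1)^*%C)).
    by apply: eq_circle_int => z z1; rewrite circle_expJ.
  by rewrite circle_intJ ?circle_int_exp_pos ?conjc0//; exact/L2_integrable/(L2_exp k.+1).
Qed.

Lemma inner_exp n m : inner (fun z : C => z ^ n) (fun z => z ^ m) = (n == m)%:R.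
Proof.
rewrite -fourierE -(subr_eq0 n) -circle_int_exp.
by apply: eq_circle_int => z /circle_neq0 z0; rewrite -expfzDr.
Qed.

Lemma fourier_exp n m : fourier (fun z : C => z ^ n) m = (n == m)%:R.
Proof. by rewrite fourierE inner_exp. Qed.

Lemma fourier_cst (a : C) n : fourier (fun=> a) n = a * (n == 0)%:R.
Proof.
rewrite eq_sym -(fourier_exp 0) -fourierZ; last exact: L2_exp.
by apply: eq_circle_int => z _; rewrite expr0z mulr1.
Qed.

Lemma orthonormal_inner (k : nat) (e : 'I_k -> C -> C) (a b : 'I_k -> C) :
  (forall i, L2 (e i)) -> is_orthonormal e ->
  inner (fun z => \sum_i a i * e i z) (fun z => \sum_i b i * e i z) =
  \sum_i a i * (b i)^*%C.
Proof.
move=> he oe; rewrite inner_suml//; last by apply: L2_sum => i; exact: L2Z.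
apply: eq_bigr => i _; rewrite inner_sumr//; congr (_ * _).
rewrite (bigD1 i)//= oe eqxx mulr1 big1 ?addr0// => j ji.
by rewrite oe eq_sym (negPf ji) mulr0.
Qed.

Definition orth_proj (k : nat) (e : 'I_k -> C -> C) f : C -> C :=
  fun z => \sum_i inner f (e i) * e i z.

Lemma L2_orth_proj (k : nat) (e : 'I_k -> C -> C) f :
  (forall i, L2 (e i)) -> L2 (orth_proj e f).
Proof. by move=> he; apply: L2_sum => i; exact: L2Z. Qed.

Lemma inner_orth_proj_basis (k : nat) (e : 'I_k -> C -> C) f i :
  (forall i, L2 (e i)) -> is_orthonormal e -> inner (orth_proj e f) (e i) = inner f (e i).
Proof.
move=> he oe; rewrite inner_suml// (bigD1 i)//= oe eqxx mulr1 big1 ?addr0// => j ji.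
by rewrite oe (negPf ji) mulr0.
Qed.

(** Subtracting the projection p of f leaves a vector of squared norm
    <f, f> - <p, p>. *)
Lemma bessel (k : nat) (e : 'I_k -> C -> C) f :
  L2 f -> (forall i, L2 (e i)) -> is_orthonormal e ->
  \sum_i Normc.normc (inner f (e i)) ^+ 2 <= normL2 f ^+ 2.
Proof.
move=> hf he oe; rewrite normL2_sq; set p := orth_proj e f.
have hp : L2 p by exact: L2_orth_proj.
have pp : inner p p = (\sum_i Normc.normc (inner f (e i)) ^+ 2)%:C.
  by rewrite orthonormal_inner// rmorph_sum; apply: eq_bigr => i _; rewrite mulc_conjc.
have fp : inner f p = inner p p.
  rewrite inner_sumr// orthonormal_inner//.
  by apply: eq_bigr => i _; rewrite mulrC.
have pf : inner p f = inner p p by rewrite innerC// fp inner_self conjc_real.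
rewrite -subr_ge0 -ler0c rmorphB /= -pp -inner_self.
suff -> : inner f f - inner p p = inner (fun z => f z - p z) (fun z => f z - p z).
  by rewrite inner_self ler0c inner_self_ge0.
have hfp : L2 (fun z => f z - p z) by exact: L2B.
rewrite innerBl// (innerC hf hfp) (innerC hp hfp) !innerBl// pf fp subrr conjc0.
by rewrite subr0 inner_self (inner_self p) -(rmorphB (real_complex R)) conjc_real.
Qed.

Lemma H2D f g : H2 f -> H2 g -> H2 (fun z => f z + g z).
Proof.
move=> [hf f0] [hg g0]; split; first exact: L2D.
by move=> n n0; rewrite fourierD// f0// g0// addr0.
Qed.

Lemma H2Z (a : C) f : H2 f -> H2 (fun z => a * f z).
Proof.
move=> [hf f0]; split; first exact: L2Z.
by move=> n n0; rewrite fourierZ// f0// mulr0.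
Qed.

Lemma H2_cst (a : C) : H2 (fun=> a).
Proof.
split; first exact: L2_cst.
by move=> n n0; rewrite fourier_cst (lt_eqF n0) mulr0.
Qed.

Lemma H2_sum (I : Type) (r : seq I) (F : I -> C -> C) : (forall i, H2 (F i)) ->
  H2 (fun z => \sum_(i <- r) F i z).
Proof.
move=> cF; elim: r => [|i r IH].
  by under eq_fun do rewrite big_nil; exact: H2_cst.
by under eq_fun do rewrite big_cons; exact: H2D.
Qed.

(** Membership tests by Fourier coefficients, which reduce every closure
    property of these spaces to a shift or a reflection of indices. *)
Lemma conjH20P f : conjH20 f <-> L2 f /\ forall n, 0 <= n -> fourier f n = 0.
Proof.
split=> [[hf [h [[hh h0] hat0 fh]]]|[hf f0]]; split => //.
  move=> n n0; rewrite (fourier_ae _ hf (L2J hh) fh) fourierJ//.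
  move: n0; rewrite le_eqVlt => /predU1P[<-|n0].
    by rewrite oppr0 -[fourier h 0]/(at0 h) hat0 conjc0.
  by rewrite h0 ?conjc0// oppr_lt0.
exists (fun z => (f z)^*%C); split.
- by split=> [|n n0]; [exact: L2J|rewrite fourierJ// f0 ?conjc0// oppr_ge0 ltW].
- by rewrite /at0 fourierJ// f0// conjc0.
- by apply: circle_ae_pointwise => z _; rewrite conjcK.
Qed.

Lemma zH2P f : zH2 f <-> L2 f /\ forall n, n <= 0 -> fourier f n = 0.
Proof.
split=> [[hf [h [hh h0] fh]]|[hf f0]].
  have hzh : L2 (fun z => z * h z) by exact: (L2_expM 1).
  split=> // n n0; rewrite (fourier_ae _ hf hzh fh) fourier_mulX h0//.
  by rewrite subr_lt0 (le_lt_trans n0).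
split=> //; exists (fun z => z ^ (-1) * f z).
  split=> [|n n0]; first exact: L2_expM.
  by rewrite fourier_shift opprK f0// -ltzD1 ltrD2r.
apply: circle_ae_pointwise => z /circle_neq0 z0.
by rewrite mulrA exprN1 divff// mul1r.
Qed.

Lemma fourier0 m : fourier (fun=> 0 : C) m = 0.
Proof. by rewrite fourier_cst mul0r. Qed.

Lemma conjH20D f h (a : C) : conjH20 f -> conjH20 h -> conjH20 (fun z => a * f z + h z).
Proof.
move=> /conjH20P[hf f0] /conjH20P[hh h0]; apply/conjH20P.
split=> [|m m0]; first by apply: L2D => //; exact: L2Z.
by rewrite fourierD ?fourierZ ?f0 ?h0 ?mulr0 ?addr0//; exact: L2Z.
Qed.

Lemma conjH20_0 : conjH20 (fun=> 0 : C).
Proof. by apply/conjH20P; split=> [|m _]; [exact: L2_cst|exact: fourier0]. Qed.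

Lemma zH2D f h (a : C) : zH2 f -> zH2 h -> zH2 (fun z => a * f z + h z).
Proof.
move=> /zH2P[hf f0] /zH2P[hh h0]; apply/zH2P.
split=> [|m m0]; first by apply: L2D => //; exact: L2Z.
by rewrite fourierD ?fourierZ ?f0 ?h0 ?mulr0 ?addr0//; exact: L2Z.
Qed.

Lemma zH2_0 : zH2 (fun=> 0 : C).
Proof. by apply/zH2P; split=> [|m _]; [exact: L2_cst|exact: fourier0]. Qed.

Lemma H2_backward_shift f : H2 f -> H2 (backward_shift f).
Proof.
move=> [hf f0]; rewrite /backward_shift.
have hb : L2 (fun z => f z - at0 f) by apply: L2B => //; exact: L2_cst.
have -> : (fun z => (f z - at0 f) / z) = (fun z => z ^ (-1) * (f z - at0 f)).
  by apply/funext => z; rewrite mulrC exprN1.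
split=> [|n n0]; first exact: L2_expM.
rewrite fourier_shift opprK fourierB//; last exact: L2_cst.
rewrite fourier_cst; have : n + 1 <= 0 by rewrite -ltzD1 ltrD2r.
rewrite le_eqVlt => /predU1P[->|n1]; first by rewrite eqxx mulr1 subrr.
by rewrite f0// (lt_eqF n1) mulr0 subrr.
Qed.

End Fourier.

(** * Polynomial approximation of a step function *)

Section Threshold.
Variable R : realType.
Implicit Types (y r s : R) (k : nat).

(** An induction-friendly form of the bound (1 - s) sum_(i < k) s^i <= 1. *)
Lemma natr_exprn_le s k : 0 <= s <= 1 -> k%:R * s ^+ k * (1 - s) <= 1 - s ^+ k.
Proof.
move=> /andP[s0 s1]; elim: k => [|k IH]; first by rewrite mul0r expr0 mul0r subrr.
have p0 : 0 <= s ^+ k by exact: exprn_ge0.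
have p1 : s ^+ k <= 1 by exact: exprn_ile1.
rewrite -natr1 exprS; set p := s ^+ k in IH p0 p1 *.
have a : 0 <= (1 - s) * (1 - s * p).
  by rewrite mulr_ge0 ?subr_ge0// mulr_ile1.
have := ler_wpM2l s0 IH; nra.
Qed.

(** Apply the previous bound to the square root of r: then k r^k is at most
    (sqrt r)^k / (1 - sqrt r). *)
Lemma cvg_nat_geometric r : 0 <= r < 1 ->
  (fun k => k%:R * r ^+ k) @ \oo --> (0 : R).
Proof.
move=> /andP[r0 r1]; pose s := Num.sqrt r.
have s0 : 0 <= s by exact: sqrtr_ge0.
have s1 : s < 1 by rewrite -sqrtr1 ltr_sqrt.
have rE : r = s ^+ 2 by rewrite sqr_sqrtr.
apply: (@squeeze_cvgr _ _ _ _ (cst 0) (geometric (1 - s)^-1 s)).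
- apply: nearW => k; apply/andP; split; first by rewrite mulr_ge0 ?exprn_ge0.
  rewrite /geometric /= rE -exprM mul2n -addnn exprD mulrA.
  rewrite ler_wpM2r ?exprn_ge0// -[leRHS]mul1r ler_pdivlMr ?subr_gt0//.
  apply: le_trans (natr_exprn_le _ _) _; first by rewrite s0 ltW.
  by rewrite lerBlDr lerDl exprn_ge0.
- exact: cvg_cst.
- by apply: cvg_geometric; rewrite ger0_norm.
Qed.

Lemma bernoulli_le y k : 0 <= y -> 1 + k%:R * y <= (1 + y) ^+ k.
Proof.
move=> y0; elim: k => [|k IH]; first by rewrite mul0r addr0 expr0.
rewrite exprS; have := ler_wpM2l (ltW (ltr_wpDr y0 ltr01)) IH.
apply: le_trans; rewrite -natr1; have : 0 <= k%:R * y ^+ 2 by rewrite mulr_ge0 ?sqr_ge0.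
by nra.
Qed.

Lemma bernoulliN_le y k : 0 <= y <= 1 -> 1 - k%:R * y <= (1 - y) ^+ k.
Proof.
move=> /andP[y0 y1]; elim: k => [|k IH]; first by rewrite mul0r subr0 expr0.
have y1' : 0 <= 1 - y by rewrite subr_ge0.
rewrite exprS; have := ler_wpM2l y1' IH.
apply: le_trans; rewrite -natr1; have : 0 <= k%:R * y ^+ 2 by rewrite mulr_ge0 ?sqr_ge0.
by nra.
Qed.

(** The factor k in the exponent makes the limit 0 also at y = 1/2, so that
    convergence to the step function holds at every point. *)
Definition threshold k y : R := (1 - y ^+ k) ^+ (k * 2 ^ k).

Lemma threshold_itv k y : 0 <= y <= 1 -> 0 <= threshold k y <= 1.
Proof.
move=> /andP[y0 y1]; have h0 : 0 <= 1 - y ^+ k by rewrite subr_ge0 exprn_ile1.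
by rewrite exprn_ge0// exprn_ile1// lerBlDr lerDl exprn_ge0.
Qed.

(** By the two Bernoulli inequalities, [threshold k y] lies above
    1 - k (2y)^k when y < 1/2, and below 1 / (1 + k (2y)^k) <= 1 / (1 + k)
    when y >= 1/2. *)
Lemma cvg_threshold y : 0 <= y <= 1 ->
  (fun k => threshold k y) @ \oo --> ((y < 2^-1)%R%:R : R).
Proof.
move=> y01; have /andP[y0 y1] := y01.
have yk k : 0 <= y ^+ k <= 1 by rewrite exprn_ge0 ?exprn_ile1.
have [yh|yh] := ltrP y 2^-1.
  apply: (@squeeze_cvgr _ _ _ _ (fun k => 1 - k%:R * (2 * y) ^+ k) (cst 1)).
  - apply: nearW => k; have /andP[_ ->] := threshold_itv k y01; rewrite andbT.
    by rewrite exprMn mulrA -natrX -natrM; exact: bernoulliN_le.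
  - rewrite -[X in _ --> X]subr0; apply: cvgB; first exact: cvg_cst.
    apply: cvg_nat_geometric; rewrite mulr_ge0//=.
    by rewrite -(@ltr_pM2l _ 2) in yh => //; rewrite mulfV in yh.
  - exact: cvg_cst.
apply: (@squeeze_cvgr _ _ _ _ (cst 0) (@harmonic R)).
- apply: nearW => k; have /andP[-> _] /= := threshold_itv k y01.
  rewrite /harmonic /= -[leLHS]mulr1 -[leRHS]mul1r ler_pdivlMr// mulr1.
  have h1 : k.+1%:R <= (1 + y ^+ k) ^+ (k * 2 ^ k).
    apply: le_trans (bernoulli_le _ (exprn_ge0 _ y0)).
    rewrite natrM natrX -mulrA -exprMn -natr1 addrC lerD2l ler_peMr//.
    apply: exprn_ege1; rewrite -(@ler_pM2l _ 2) in yh => //.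
    by rewrite mulfV in yh.
  apply: le_trans (ler_wpM2l _ h1) _; first by case/andP: (threshold_itv k y01).
  rewrite -exprMn exprn_ile1//; have /andP[a b] := yk k; nra.
- exact: cvg_cst.
- exact: cvg_harmonic.
Qed.

End Threshold.

(** * Uniqueness of Fourier coefficients *)

Section Uniqueness.
Variable R : realType.
Local Notation C := R[i].
Local Notation mu := (@lebesgue_measure R).
Local Notation angles := (@angles R).
Implicit Types (f g h P Q : C -> C) (z w : C) (n : int).

Definition null_coeffs f : Prop := L2 f /\ forall n, fourier f n = 0.

(** Multipliers that preserve the functions whose coefficients all vanish: they
    form an algebra, so the approximation below may take products before
    passing to the limit. *)
Definition keeps_null P : Prop :=
  Linfty P /\ forall f, null_coeffs f -> null_coeffs (fun z => P z * f z).

Lemma keeps_null_cst (a : C) : keeps_null (fun=> a).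
Proof.
split=> [|f [hf f0]]; first exact/circle_continuous_Linfty/circle_continuous_cst.
by split=> [|n]; [exact: L2Z|rewrite fourierZ// f0 mulr0].
Qed.

Lemma keeps_null_exp n : keeps_null (fun z => z ^ n).
Proof.
split=> [|f [hf f0]]; first exact/circle_continuous_Linfty/circle_continuous_exp.
by split=> [|m]; [exact: L2_expM|rewrite fourier_shift f0].
Qed.

Lemma keeps_nullM P Q : keeps_null P -> keeps_null Q ->
  keeps_null (fun z => P z * Q z).
Proof.
move=> [bP hP] [bQ hQ]; split=> [|f hf]; first exact: LinftyM.
by under eq_fun do rewrite -mulrA; exact/hP/hQ.
Qed.

Lemma keeps_nullD P Q : keeps_null P -> keeps_null Q ->
  keeps_null (fun z => P z + Q z).
Proof.
move=> [bP hP] [bQ hQ]; split=> [|f hf]; first exact: LinftyD.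
have [p1 p2] := hP _ hf; have [q1 q2] := hQ _ hf.
under eq_fun do rewrite mulrDl; split; first exact: L2D.
by move=> n; rewrite fourierD// p2 q2 addr0.
Qed.

Lemma keeps_null_pow P k : keeps_null P -> keeps_null (fun z => P z ^+ k).
Proof.
move=> hP; elim: k => [|k IH]; first exact: keeps_null_cst.
by under eq_fun do rewrite exprS; exact: keeps_nullM.
Qed.

Lemma keeps_null_ext P Q : (forall z, z * z^*%C = 1 -> P z = Q z) ->
  keeps_null P -> keeps_null Q.
Proof.
move=> PQ [[[m1 m2] [M hM]] hP].
have bQ : Linfty Q.
  split; last by exists M; apply: ae_angles1 hM => t _; rewrite PQ// cis_mulJ.
  split; [apply: eq_measurable_fun m1|apply: eq_measurable_fun m2];
    by move=> t _ /=; rewrite PQ// cis_mulJ.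
split=> // f hf; have [h1 h2] := hP _ hf; have [hf1 _] := hf.
have hQf : L2 (fun z => Q z * f z) by exact: L2M.
split=> // n; rewrite -(h2 n); apply: fourier_ae => //.
by apply: circle_ae_pointwise => z z1; rewrite PQ.
Qed.

Lemma Rintegral_bounded_cvg0 (p_ : nat -> R -> R) (p u : R -> R) :
  (forall k, measurable_fun angles (p_ k)) ->
  (forall k t, 0 <= p_ k t <= 1) ->
  (forall t, p_ ^~ t @ \oo --> p t) ->
  mu.-integrable angles (EFin \o u) ->
  (forall k, \int[mu]_(t in angles) (p_ k t * u t) = 0) ->
  \int[mu]_(t in angles) (p t * u t) = 0.
Proof.
move=> mp p01 cp iu int0.
have mu' : measurable_fun angles u.
  by apply/measurable_EFinP; exact: measurable_int iu.
have mpf : measurable_fun angles p by apply: measurable_fun_cvg => // t _; exact: cp.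
have m_ k : measurable_fun angles (fun t => p_ k t * u t) by exact: measurable_funM.
have m : measurable_fun angles (fun t => p t * u t) by exact: measurable_funM.
have [] := @dominated_convergence _ _ _ mu angles _
  (fun k t => (p_ k t * u t)%:E) (fun t => (p t * u t)%:E) (fun t => `|u t|%:E).
- exact: measurable_itv.
- by move=> k; apply/measurable_EFinP; exact: m_.
- by apply/measurable_EFinP; exact: m.
- apply: aeW => t _; apply: cvg_EFin; first exact: nearW.
  by apply: cvgM; [exact: cp|exact: cvg_cst].
- by apply: integrable_abse iu; exact: measurable_itv.
- apply: aeW => t k _ /=; rewrite lee_fin normrM ler_piMl//.
  by have /andP[a b] := p01 k t; rewrite ger0_norm.
move=> _ _ c; suff -> : \int[mu]_(t in angles) (p t * u t) = fine 0 by [].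
congr fine; apply/esym; apply: (cvg_unique _ _ c) => //.
rewrite [X in X @ _](_ : _ = cst 0%E); first exact: cvg_cst.
apply/funext => k /=; rewrite -[LHS]fineK; first by congr EFin; exact: int0.
apply: integrable_fin_num; first exact: measurable_itv.
apply: (@ae_le_integrable _ (fun t => p_ k t * u t) (fun t => `|u t|)).
- exact: m_.
- apply: aeW => t _; rewrite normrM ler_piMl//.
  by have /andP[a b] := p01 k t; rewrite ger0_norm.
- by apply: integrable_abse iu; exact: measurable_itv.
Qed.



(** Dominated convergence, applied to each Fourier coefficient. *)
Lemma keeps_null_lim (P_ : nat -> C -> C) (p_ : nat -> C -> R) (p : C -> R) :
  (forall k, keeps_null (P_ k)) ->
  (forall k z, z * z^*%C = 1 -> P_ k z = (p_ k z)%:C) ->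
  (forall k z, 0 <= p_ k z <= 1) -> (forall z, 0 <= p z <= 1) ->
  (forall t, (fun k => p_ k (cis t)) @ \oo --> p (cis t)) ->
  keeps_null (fun z => (p z)%:C).
Proof.
move=> hP hp p_01 p01 cp.
have mp k : measurable_fun angles (fun t => p_ k (cis t)).
  have [[[m _] _] _] := hP k; apply: eq_measurable_fun m => t _.
  by rewrite hp// cis_mulJ.
have mpf : measurable_fun angles (fun t => p (cis t)).
  by apply: (measurable_fun_cvg (h := fun k t => p_ k (cis t))) => // t _; exact: cp.
have bp : Linfty (fun z => (p z)%:C).
  split; first by split => //=; exact: measurable_cst.
  exists 1; apply: aeW => t _ /=; rewrite expr0n /= addr0 sqrtr_sqr.
  by have /andP[a b] := p01 (cis t); rewrite ger0_norm.
split=> // f nf; have [hf f0] := nf.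
have hpf : L2 (fun z => (p z)%:C * f z) by exact: L2M.
split=> // n.
have [i1 i2] : circle_integrable (fun z => z ^ (- n) * f z).
  by apply: L2_integrableM => //; exact: L2_exp.
have pE (x : R) (y : C) m : x%:C * y * m = x%:C * (m * y).
  by rewrite -mulrA (mulrC m).
have ReZ (x : R) (y : C) : Re (x%:C * y) = x * Re y.
  by rewrite Re_mulc /= mul0r subr0.
have ImZ (x : R) (y : C) : Im (x%:C * y) = x * Im y.
  by rewrite Im_mulc /= mul0r addr0.
have int0 k : circle_int (fun z => (p_ k z)%:C * (z ^ (- n) * f z)) = 0.
  have [_ h] := (hP k).2 _ nf; rewrite -(h n).
  by apply: eq_circle_int => z z1; rewrite hp// pE.
have pi0 : (2 * pi : R)^-1 != 0 by rewrite invr_eq0 gt_eqF// pi2_gt0.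
have [e1 e2] : (forall k, \int[mu]_(t in angles) (p_ k (cis t) * Re (cis t ^ (- n) * f (cis t))) = 0) /\
     (forall k, \int[mu]_(t in angles) (p_ k (cis t) * Im (cis t ^ (- n) * f (cis t))) = 0).
  split=> k; have := int0 k => -[/eqP + /eqP]; rewrite !mulf_eq0 (negPf pi0) /= => /eqP h1 /eqP h2.
    by rewrite -h1; apply: eq_Rintegral => t _; rewrite ReZ.
  by rewrite -h2; apply: eq_Rintegral => t _; rewrite ImZ.
rewrite /fourier; under eq_circle_int do rewrite pE.
apply/eqP; rewrite eq_complex /= !mulf_eq0 (negPf pi0) /=; apply/andP; split; apply/eqP.
  rewrite -[RHS](Rintegral_bounded_cvg0 mp (fun k t => p_01 k (cis t)) cp i1 e1).
  by apply: eq_Rintegral => t _; rewrite ReZ.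
rewrite -[RHS](Rintegral_bounded_cvg0 mp (fun k t => p_01 k (cis t)) cp i2 e2).
by apply: eq_Rintegral => t _; rewrite ImZ.
Qed.

(** Compose [threshold] with (1 - Re (z conj w)) / 2, a trigonometric polynomial with
    values in [0, 1] that is below 1/2 exactly on the open half circle
    centred at w. *)
Lemma keeps_null_half w : w * w^*%C = 1 ->
  keeps_null (fun z => ((0 < Re (z * w^*%C))%R%:R : R)%:C).
Proof.
move=> w1.
(* Truncation is invisible on the circle and makes the bounds hold everywhere. *)
pose c z : R := Num.max (-1) (Num.min 1 (Re (z * w^*%C))).
pose y z : R := (1 - c z) / 2.
have y01 z : 0 <= y z <= 1.
  have c1 : -1 <= c z by rewrite le_max lexx.
  have c2 : c z <= 1 by rewrite ge_max ge_min lexx andbT (le_trans _ ler01)// oppr_le0.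
  by rewrite /y; apply/andP; split; lra.
have cE z : z * z^*%C = 1 -> c z = Re (z * w^*%C).
  move=> z1; have : `|Re (z * w^*%C)| <= 1.
    apply: le_trans (abs_Re_le _) _; rewrite Normc.normcM normc_conjc.
    rewrite mulc_conjc in z1; rewrite mulc_conjc in w1.
    move: z1 w1 => [/eqP + ] [/eqP +].
    by rewrite !sqrp_eq1 ?normc_nneg// => /eqP -> /eqP ->; rewrite mulr1.
  by rewrite ler_norml /c => /andP[a b]; rewrite min_r// max_r.
have yP : keeps_null (fun z => (y z)%:C).
  apply: (@keeps_null_ext (fun z => 2^-1 + (- 4^-1) * (z ^ 1 * w^*%C + z ^ (-1) * w))).
    move=> z z1; rewrite /y cE// circle_expJ// expr1z.
    have := addcJ (z * w^*%C); rewrite conjcM conjcK => ->.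
    by apply/eqP; rewrite eq_complex; case: (z * _) => a b /=; apply/andP; split; apply/eqP; field.
  apply: keeps_nullD; first exact: keeps_null_cst.
  apply: keeps_nullM; first exact: keeps_null_cst.
  by apply: keeps_nullD; apply: keeps_nullM; (exact: keeps_null_exp || exact: keeps_null_cst).
apply: (@keeps_null_lim (fun k z => (1 + (-1) * (y z)%:C ^+ k) ^+ (k * 2 ^ k))
  (fun k z => threshold k (y z)) (fun z => (0 < Re (z * w^*%C))%R%:R)).
- move=> k; apply/keeps_null_pow/keeps_nullD; first exact: keeps_null_cst.
  by apply: keeps_nullM; [exact: keeps_null_cst|exact: keeps_null_pow].
- by move=> k z z1; rewrite /threshold mulN1r rmorphXn rmorphB rmorphXn rmorph1.
- by move=> k z; exact: threshold_itv.
- by move=> z; case: (0 < _); rewrite ?lexx ?ler01.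
- move=> t; have := cvg_threshold (y01 (cis t)).
  suff -> : (y (cis t) < 2^-1) = (0 < Re (cis t * w^*%C)) by [].
  by rewrite /y cE ?cis_mulJ//; set a := Re _; apply/idP/idP; lra.
Qed.

Lemma keeps_null_arc (a b : R) :
  keeps_null (fun z => ((0 < Re (z * (cis a)^*%C)) && (0 < Re (z * (cis b)^*%C)))%R%:R%:C).
Proof.
have := keeps_nullM (keeps_null_half (cis_mulJ a)) (keeps_null_half (cis_mulJ b)).
apply: keeps_null_ext => z _.
by case: (0 < _); case: (0 < _); rewrite -(rmorphM (real_complex R)) /= ?mulr1 ?mulr0 ?mul0r.
Qed.

Lemma sin_gt0_0pi (t : R) : 0 <= t <= 2 * pi -> (0 < sin t) = (0 < t < pi).
Proof.
move=> /andP[t0 t2]; apply/idP/idP; last by move=> h; exact: sin_gt0_pi.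
move=> st; rewrite lt_neqAle t0 andbT; apply/andP; split.
  by apply: contraTneq st => <-; rewrite sin0 ltxx.
rewrite ltNge; apply/negP => pt; have : 0 <= sin (t - pi).
  by apply: sin_ge0_pi; apply/andP; split; lra.
by rewrite sinB cospi sinpi; lra.
Qed.

Lemma ae_neq (c : R) : {ae mu, forall t, angles t -> t != c}.
Proof.
exists [set c]; split; [exact: measurable_set1|exact: lebesgue_measure_set1|].
by move=> t /= /not_implyP[_ /negP]; rewrite negbK => /eqP.
Qed.

(** The primitive of u from 0 vanishes on both open halves of the interval, hence
    so does its derivative, which is u almost everywhere.  Only arcs inside one
    half are assumed, since these are intersections of two half circles. *)
Lemma ae_eq0_of_arc_integrals (u : R -> R) : mu.-integrable angles (EFin \o u) ->
  \int[mu]_(t in angles) u t = 0 ->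
  (forall x, 0 < x < pi -> \int[mu]_(t in `]0, x[) u t = 0) ->
  (forall x, pi < x < 2 * pi -> \int[mu]_(t in `]x, 2 * pi[) u t = 0) ->
  {ae mu, forall t, angles t -> u t = 0}.
Proof.
move=> iu u0 ul ur; have pi0 := pi_gt0 R.
have mA : measurable (angles : set (measurableTypeR R)) by exact: measurable_itv.
have sub (i : interval R) : [set` i] `<=` angles -> mu.-integrable [set` i] (EFin \o u).
  by move=> h; apply: integrableS iu; [exact: measurable_itv..|exact: h].
pose v := u \_ angles.
have iv : mu.-integrable setT (EFin \o v).
  by rewrite /v -restrict_EFin; apply/(integrable_mkcond _ mA).
have ivy y : mu.-integrable [set` Interval (BLeft 0) (BRight y)] (EFin \o v).
  by apply: integrableS iv; [exact: measurableT|exact: measurable_itv|].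
have locv : locally_integrable setT v by exact: integrable_locally.
have := FTC1 ivy locv; set F := fun x => _ => H.
have FE y : y <= 2 * pi -> F y = \int[mu]_(t in `[0, y]) u t.
  move=> y2; apply: eq_Rintegral => t; rewrite inE /= in_itv /= => /andP[t0 ty].
  by rewrite /v patchT//; apply/mem_set; rewrite /Defs.angles /= in_itv /= t0 (le_trans ty).
have Fl y : 0 < y < pi -> F y = 0.
  move=> /andP[y0 y1]; rewrite FE; last by lra.
  rewrite -Rintegral_itv_bndo_bndc; last first.
    by apply: sub => t; rewrite /Defs.angles /= !in_itv /= => /andP[a b]; apply/andP; split; lra.
  rewrite -Rintegral_itv_obnd_cbnd; last first.
    by apply: sub => t; rewrite /Defs.angles /= !in_itv /= => /andP[a b]; apply/andP; split; lra.
  by apply: ul; rewrite y0.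
have Fr y : pi < y < 2 * pi -> F y = 0.
  move=> /andP[y0 y1]; rewrite FE; last by lra.
  have e : (BLeft 0 <= BRight y)%O by rewrite bnd_simp; lra.
  have e' : (BRight y <= BRight (2 * pi))%O by rewrite bnd_simp; lra.
  have := Rintegral_itvB iu e e'.
  rewrite [X in X - _]u0 sub0r.
  rewrite -(@Rintegral_itv_bndo_bndc _ (BRight y) (2 * pi) u); last first.
    by apply: sub => t; rewrite /Defs.angles /= !in_itv /= => /andP[a b]; apply/andP; split; lra.
  by rewrite ur ?y0// => /eqP; rewrite oppr_eq0 => /eqP.
have loc0 (x : R) : (\forall y \near x, F y = 0) -> derive1 F x = 0.
  by move=> h; rewrite derive1E (near_eq_derive _ (g := cst 0))// derive_cst.
have H' : {ae mu, forall t, angles t -> (0 < t -> derive1 F t = v t)}.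
  apply: (@filterS _ _ (ae_filter_ringOfSetsType mu)) H => t h _ t0.
  by case: h; rewrite ?bnd_simp// ltW.
have n3 := ae_angles2 (fun t _ a b => conj a b) (ae_neq 0)
  (ae_angles2 (fun t _ a b => conj a b) (ae_neq pi) (ae_neq (2 * pi))).
apply: ae_angles2 H' n3 => t At h [t0 [t1 t2]].
have tA : 0 <= t <= 2 * pi by move: At; rewrite /Defs.angles /= in_itv.
have <- : v t = u t by rewrite /v patchT//; exact/mem_set.
move: tA => /andP[]; rewrite le_eqVlt eq_sym (negPf t0) /= => {}t0.
rewrite le_eqVlt (negPf t2) /= => {}t2.
rewrite -h//; apply: loc0; have [tp|tp] : t < pi \/ pi < t.
- by apply/orP; rewrite -neq_lt.
- have : t \in `]0, pi[ by rewrite in_itv /= t0.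
  by move=> /near_in_itvoo; apply: filterS => y; rewrite in_itv; exact: Fl.
- have : t \in `]pi, 2 * pi[ by rewrite in_itv /= tp.
  by move=> /near_in_itvoo; apply: filterS => y; rewrite in_itv; exact: Fr.
Qed.


Lemma null_coeffs_arc f (a b lo hi : R) : null_coeffs f ->
  (forall t, 0 <= t <= 2 * pi ->
     ((0 < cos (t - a)) && (0 < cos (t - b))) = (lo < t < hi)) ->
  0 <= lo -> hi <= 2 * pi ->
  \int[mu]_(t in `]lo, hi[) Re (f (cis t)) = 0 /\
  \int[mu]_(t in `]lo, hi[) Im (f (cis t)) = 0.
Proof.
move=> nf arcE lo0 hi2.
have arcI : `]lo, hi[%classic = angles `&` `]lo, hi[%classic.
  apply/seteqP; split=> t; rewrite /Defs.angles /= !in_itv /=; last by case.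
  by move=> /andP[x y]; split; apply/andP; split; lra.
have [_ /(_ 0) H] := (keeps_null_arc a b).2 _ nf.
have pi0 : (2 * pi : R)^-1 != 0 by rewrite invr_eq0 gt_eqF// pi2_gt0.
have E (u : R -> R) : \int[mu]_(t in `]lo, hi[) u t =
    \int[mu]_(t in angles) (((0 < cos (t - a)) && (0 < cos (t - b)))%R%:R * u t).
  rewrite arcI Rintegral_mkcondr; apply: eq_Rintegral => t.
  rewrite inE /Defs.angles /= in_itv /= => At; rewrite arcE// patchE.
  rewrite (_ : (t \in `]lo, hi[%classic) = (lo < t < hi)); last first.
    by apply/idP/idP; rewrite inE /= in_itv.
  by case: ifP => _; rewrite ?mul1r ?mul0r.
move: H => [/eqP + /eqP]; rewrite !mulf_eq0 (negPf pi0) !orFb => /eqP h1 /eqP h2.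
split; rewrite E.
  rewrite -[RHS]h1; apply: eq_Rintegral => t _.
  by rewrite oppr0 expr0z mulr1 !cosB !mulrN !opprK Re_mulc [Re _%:C]/= [Im _%:C]/= mul0r subr0.
rewrite -[RHS]h2; apply: eq_Rintegral => t _.
by rewrite oppr0 expr0z mulr1 !cosB !mulrN !opprK Im_mulc [Re _%:C]/= [Im _%:C]/= mul0r addr0.
Qed.

Lemma cosBpihalf (t : R) : cos (t - pi / 2) = sin t.
Proof. by rewrite cosB cos_pihalf sin_pihalf mulr0 mulr1 add0r. Qed.

Lemma sin_arcl (x t : R) : 0 < x < pi -> 0 <= t <= 2 * pi ->
  ((0 < sin t) && (0 < sin (x - t))) = (0 < t < x).
Proof.
move=> /andP[x0 x1] ht; rewrite sin_gt0_0pi//; apply/idP/idP => /andP[].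
  move=> /andP[t0 t1] s0; rewrite t0 ltNge; apply/negP => xt.
  have : 0 <= sin (t - x) by apply: sin_ge0_pi; apply/andP; split; lra.
  by rewrite -opprB sinN in s0 *; lra.
move=> t0 tx; rewrite t0 (lt_trans tx x1)/=; apply: sin_gt0_pi.
by apply/andP; split; lra.
Qed.

(** Arcs inside the upper or the lower half circle are intersections of two half
    circles, so the integral of f over them is a Fourier coefficient of f times
    a multiplier. *)
Lemma fourier_inj0 f : L2 f -> (forall n, fourier f n = 0) -> circle_ae f (fun=> 0).
Proof.
move=> hf f0; have nf : null_coeffs f by [].
have pi0 := pi_gt0 R.
have left x : 0 < x < pi -> \int[mu]_(t in `]0, x[) Re (f (cis t)) = 0 /\
    \int[mu]_(t in `]0, x[) Im (f (cis t)) = 0.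
  move=> /andP[x0 x1]; apply: (@null_coeffs_arc f (pi / 2) (x - pi / 2)) => //; last by lra.
  move=> t ht; rewrite cosBpihalf -sin_arcl ?x0//.
  have -> : t - (x - pi / 2) = - ((x - t) - pi / 2) by lra.
  by rewrite cosN cosBpihalf.
have right x : pi < x < 2 * pi -> \int[mu]_(t in `]x, 2 * pi[) Re (f (cis t)) = 0 /\
    \int[mu]_(t in `]x, 2 * pi[) Im (f (cis t)) = 0.
  move=> /andP[x0 x1]; apply: (@null_coeffs_arc f (- (pi / 2)) (x + pi / 2)) => //; last by lra.
  move=> t /andP[t0 t1].
  have -> : t - (x + pi / 2) = (t - x) - pi / 2 by lra.
  have -> : t - - (pi / 2) = - ((- t) - pi / 2) by lra.
  rewrite cosN !cosBpihalf.
  have -> : - t = (2 * pi - t) - pi *+ 2 by lra.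
  have -> : t - x = (2 * pi - x) - (2 * pi - t) by lra.
  rewrite sinB cos2pi sin2pi mulr1 mulr0 subr0 sin_arcl; first by apply/idP/idP; lra.
    by apply/andP; split; lra.
  by apply/andP; split; lra.
have [i1 i2] := L2_integrable hf.
have pi1 : (2 * pi : R)^-1 != 0 by rewrite invr_eq0 gt_eqF// pi2_gt0.
have : circle_int f = 0.
  by rewrite -[RHS](f0 0); apply: eq_circle_int => z _; rewrite oppr0 expr0z mulr1.
move=> [/eqP + /eqP]; rewrite !mulf_eq0 (negPf pi1) /= => /eqP h1 /eqP h2.
have e1 := ae_eq0_of_arc_integrals i1 h1 (fun x hx => (left x hx).1) (fun x hx => (right x hx).1).
have e2 := ae_eq0_of_arc_integrals i2 h2 (fun x hx => (left x hx).2) (fun x hx => (right x hx).2).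
move: e1 e2; apply: ae_angles2 => t _ a b.
by apply/eqP; rewrite eq_complex /= a b !eqxx.
Qed.

End Uniqueness.

(** * Conjugate transposes *)

Section Adjoint.
Variable R : realType.
Local Notation C := R[i].

Definition adjmx m n (A : 'M[C]_(m, n)) : 'M[C]_(n, m) := (map_mx conjc A)^T.

Lemma adjmxE m n (A : 'M[C]_(m, n)) i j : adjmx A i j = (A j i)^*%C.
Proof. by rewrite !mxE. Qed.

Lemma adjmxM m n k (A : 'M[C]_(m, n)) (B : 'M[C]_(n, k)) :
  adjmx (A *m B) = adjmx B *m adjmx A.
Proof.
apply/matrixP => i j; rewrite !mxE conjc_sum; apply: eq_bigr => l _.
by rewrite conjcM !mxE mulrC.
Qed.

Lemma adjmxK m n (A : 'M[C]_(m, n)) : adjmx (adjmx A) = A.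
Proof. by apply/matrixP => i j; rewrite !mxE conjcK. Qed.

Lemma adjmxD m n (A B : 'M[C]_(m, n)) : adjmx (A + B) = adjmx A + adjmx B.
Proof. by apply/matrixP => i j; rewrite !mxE conjcD. Qed.

Lemma adjmxZ m n a (A : 'M[C]_(m, n)) : adjmx (a *: A) = a^*%C *: adjmx A.
Proof. by apply/matrixP => i j; rewrite !mxE conjcM. Qed.

Lemma adjmxN m n (A : 'M[C]_(m, n)) : adjmx (- A) = - adjmx A.
Proof. by apply/matrixP => i j; rewrite !mxE rmorphN. Qed.

Lemma adjmx1 n : adjmx (1%:M : 'M[C]_n) = 1%:M.
Proof. by apply/matrixP => i j; rewrite !mxE eq_sym; case: eqP => _; rewrite ?conjc1 ?conjc0. Qed.

Lemma mulmx_adj_row n (x : 'rV[C]_n) :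
  (x *m adjmx x) 0 0 = (\sum_j Normc.normc (x 0 j) ^+ 2)%:C.
Proof.
rewrite mxE rmorph_sum; apply: eq_bigr => j _.
by rewrite adjmxE mulc_conjc.
Qed.

Lemma sum_normc_eq0 n (x : 'rV[C]_n) : \sum_j Normc.normc (x 0 j) ^+ 2 = 0 -> x = 0.
Proof.
move=> /eqP; rewrite psumr_eq0 => [/allP h|j _]; last exact: sqr_ge0.
apply/rowP => j; rewrite mxE; have := h j; rewrite mem_index_enum sqrf_eq0 => /(_ isT).
by move=> /eqP/Normc.eq0_normc.
Qed.

Lemma mulmx_adj_eq0 n (x : 'rV[C]_n) : x *m adjmx x = 0 -> x = 0.
Proof.
move=> /(congr1 (fun M => fun_of_matrix M 0 0)); rewrite mulmx_adj_row mxE => /complexI.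
exact: sum_normc_eq0.
Qed.

Lemma nonfree_kernel m k (A : 'M[C]_(m, k)) : ~~ row_free A ->
  exists2 x : 'rV[C]_m, x != 0 & x *m A = 0.
Proof.
rewrite -kermx_eq0 => /rowV0Pn[x xA x0]; exists x => //.
by apply/sub_kermxP.
Qed.

(** The splitting of |x|^2 that expresses x e as an orthogonal sum. *)
Lemma mulmx_adj_split n p (A : 'M[C]_n) (D : 'M[C]_(n, p)) (x : 'rV[C]_n) :
  A *m adjmx A + D *m adjmx D = 1%:M ->
  x *m adjmx x = (x *m A) *m adjmx (x *m A) + (x *m D) *m adjmx (x *m D).
Proof.
by move=> AD1; rewrite -{1}[x]mulmx1 -AD1 mulmxDr mulmxDl !adjmxM !mulmxA.
Qed.

End Adjoint.

(** * The resolvent of a contraction on the circle *)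

Section Resolvent.
Variable R : realType.
Local Notation C := R[i].
Implicit Types (f g h : C -> C) (z : C).

Lemma circle_continuous_det n (M : C -> 'M[C]_n) :
  (forall i j, circle_continuous (fun z => M z i j)) ->
  circle_continuous (fun z => \det (M z)).
Proof.
move=> cM; apply: circle_continuous_sum => s; apply: circle_continuousM.
  exact: circle_continuous_cst.
by apply: circle_continuous_prod => i.
Qed.

(** Cramer's rule. *)
Lemma circle_continuous_invmx n (M : C -> 'M[C]_n) :
  (forall i j, circle_continuous (fun z => M z i j)) ->
  (forall z, z * z^*%C = 1 -> M z \in unitmx) ->
  forall i j, circle_continuous (fun z => invmx (M z) i j).
Proof.
move=> cM uM i j.
apply: (@circle_continuous_ext R (fun z => (\det (M z))^-1 * cofactor (M z) j i)).
  by move=> z /uM u; rewrite /invmx u !mxE.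
apply: circle_continuousM.
  apply: circle_continuousV; first exact: circle_continuous_det.
  by move=> z /uM; rewrite unitmxE unitfE.
apply: circle_continuousM; first exact: circle_continuous_cst.
apply: circle_continuous_det => k l.
by under eq_fun do rewrite !mxE.
Qed.

Variables (n p : nat) (A : 'M[C]_n) (D : 'M[C]_(n, p)).
Hypothesis AD1 : A *m adjmx A + D *m adjmx D = 1%:M.
Hypothesis unitA : forall z, z * z^*%C = 1 -> 1%:M - z *: A \in unitmx.

Definition resolvent z : 'M[C]_n := invmx (1%:M - z *: A).
Local Notation B := resolvent.

Lemma resolventV z : z * z^*%C = 1 -> B z *m (1%:M - z *: A) = 1%:M.
Proof. by move=> /unitA u; rewrite mulVmx. Qed.

Lemma resolventE z : z * z^*%C = 1 -> B z = 1%:M + z *: (B z *m A).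
Proof.
move=> /resolventV; rewrite mulmxBr mulmx1 scalemxAr => /eqP.
by rewrite subr_eq => /eqP.
Qed.

Lemma resolventEr z : z * z^*%C = 1 -> B z = 1%:M + z *: (A *m B z).
Proof.
move=> /unitA/mulmxV; rewrite -/(B z) mulmxBl mul1mx scalemxAl => /eqP.
by rewrite subr_eq => /eqP.
Qed.

Lemma resolvent_continuous i j : circle_continuous (fun z => B z i j).
Proof.
apply: circle_continuous_invmx => // k l.
apply: (@circle_continuous_ext R (fun z => (1%:M : 'M[C]_n) k l + z * (- A k l))).
  by move=> z _; rewrite !mxE mulrN.
apply: circle_continuousD; first exact: circle_continuous_cst.
by apply: circle_continuousM; [exact: circle_continuous_id|exact: circle_continuous_cst].
Qed.

Lemma L2_resolvent i j : L2 (fun z => B z i j).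
Proof. exact/circle_continuous_L2/resolvent_continuous. Qed.

Definition resolvent_coef (m : int) : 'M[C]_n := \matrix_(i, j) fourier (fun z => B z i j) m.

Lemma resolvent_coef_rec m : resolvent_coef m = (m == 0)%:R%:M + resolvent_coef (m - 1) *m A.
Proof.
apply/matrixP => i j; rewrite !mxE.
have L2s : L2 (fun z => \sum_k A k j * B z i k).
  by apply: L2_sum => k; apply/L2Z/L2_resolvent.
transitivity (fourier (fun z => (1%:M : 'M[C]_n) i j + z ^ 1 * (\sum_k A k j * B z i k)) m).
  apply: eq_circle_int => z z1; congr (_ * _); rewrite {1}resolventE// !mxE expr1z.
  by congr (_ + _ * _); apply: eq_bigr => k _; rewrite mulrC.
rewrite fourierD; [|exact: L2_cst|exact: L2_expM].
rewrite fourier_cst fourier_shift fourier_sum; last by move=> k; exact: L2_resolvent.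
congr (_ + _); first by rewrite mxE; case: (i == j); case: (m == 0); rewrite /= ?mulr1 ?mulr0.
by apply: eq_bigr => k _; rewrite mxE mulrC.
Qed.

(** The part of |x|^2 carried by D is nonnegative. *)
Lemma sum_normc_contract (x : 'rV[C]_n) :
  \sum_j Normc.normc ((x *m A) 0 j) ^+ 2 <= \sum_j Normc.normc (x 0 j) ^+ 2.
Proof.
have := congr1 (fun M => fun_of_matrix M 0 0) (mulmx_adj_split x AD1).
rewrite [RHS]mxE !mulmx_adj_row -(rmorphD (real_complex R)) => /complexI ->.
by rewrite lerDl sumr_ge0// => j _; exact: sqr_ge0.
Qed.

Definition coef_row_norm (m : int) i : R := \sum_j Normc.normc (resolvent_coef m i j) ^+ 2.

Lemma coef_row_norm_le (m : int) i : m < 0 -> coef_row_norm m i <= coef_row_norm (m - 1) i.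
Proof.
move=> m0; have := sum_normc_contract (row i (resolvent_coef (m - 1))).
have e : resolvent_coef m = resolvent_coef (m - 1) *m A by rewrite resolvent_coef_rec (lt_eqF m0) raddf0 add0r.
rewrite -row_mul -e /coef_row_norm.
by under eq_bigr do rewrite mxE; under [leRHS]eq_bigr do rewrite mxE.
Qed.

Lemma coef_row_norm_bound (m : int) i (N : nat) :
  \sum_(k < N) coef_row_norm (m - k%:Z) i <= \sum_j normL2 (fun z => B z i j) ^+ 2.
Proof.
rewrite exchange_big /=; apply: ler_sum => j _.
apply: le_trans (@bessel R N (fun k z => z ^ (m - k%:Z)) _ (L2_resolvent i j) _ _).
- by apply: ler_sum => k _; rewrite mxE fourierE.
- by move=> k; exact: L2_exp.
- move=> k l; rewrite inner_exp; congr (nat_of_bool _)%:R.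
  by rewrite (inj_eq (addrI _)) eqr_opp.
Qed.

(** Going to the left, the norm of a row of coefficients can only grow, while
    finitely many such norms have a sum bounded independently of their number. *)
Lemma resolvent_coef_lt0 (m : int) : m < 0 -> resolvent_coef m = 0.
Proof.
move=> m0; apply/matrixP => i j; rewrite [RHS]mxE.
suff : \sum_j Normc.normc (row i (resolvent_coef m) 0 j) ^+ 2 = 0.
  by move=> /sum_normc_eq0/rowP/(_ j); rewrite !mxE.
under eq_bigr do rewrite mxE; rewrite -/(coef_row_norm m i).
have q0 l : 0 <= coef_row_norm l i by apply: sumr_ge0 => k _; exact: sqr_ge0.
have qle (k : nat) : coef_row_norm m i <= coef_row_norm (m - k%:Z) i.
  elim: k => [|k IH]; first by rewrite subr0.
  apply: (le_trans IH); rewrite -addn1 PoszD opprD addrA; apply: coef_row_norm_le.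
  by rewrite subr_lt0 (lt_le_trans m0).
set S := \sum_j normL2 (fun z => B z i j) ^+ 2.
have bound (N : nat) : N%:R * coef_row_norm m i <= S.
  apply: le_trans (coef_row_norm_bound m i N).
  by rewrite mulr_natl -[X in _ *+ X]card_ord -sumr_const; apply: ler_sum => k _.
apply/eqP; rewrite eq_le q0 andbT leNgt; apply/negP => qgt0.
have := bound (Num.truncn (S / coef_row_norm m i)).+1.
rewrite leNgt -ltr_pdivrMr// => /negP; apply.
exact: truncnS_gt.
Qed.

Lemma resolvent_coef0 : resolvent_coef 0 = 1%:M.
Proof. by rewrite resolvent_coef_rec eqxx sub0r resolvent_coef_lt0// mul0mx addr0. Qed.

(** Scalar transfer functions: those with v a column of D are the components of
    the parametrising space, those with v = x^* appear in its Gram matrix. *)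
Definition transfer (u : 'rV[C]_n) (v : 'cV[C]_n) z : C := (u *m B z *m v) 0 0.

Lemma transfer_sum u v z : transfer u v z = \sum_i (u 0 i * \sum_j v j 0 * B z i j).
Proof.
rewrite /transfer -mulmxA mxE; apply: eq_bigr => i _; congr (_ * _).
by rewrite mxE; apply: eq_bigr => j _; rewrite mulrC.
Qed.

Lemma transfer_delta (x : 'rV[C]_n) (v : 'cV[C]_n) z :
  transfer x v z = \sum_i x 0 i * transfer (delta_mx 0 i) v z.
Proof.
rewrite {1}(row_sum_delta x) /transfer !mulmx_suml summxE.
by apply: eq_bigr => i _; rewrite -!scalemxAl mxE.
Qed.

Lemma L2_transfer u v : L2 (transfer u v).
Proof.
rewrite (funext (transfer_sum u v)); apply: L2_sum => i; apply: L2Z.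
by apply: L2_sum => j; apply/L2Z/L2_resolvent.
Qed.

Lemma fourier_transfer u v m : fourier (transfer u v) m = (u *m resolvent_coef m *m v) 0 0.
Proof.
have h i : L2 (fun z => \sum_j v j 0 * B z i j).
  by apply: L2_sum => j; apply/L2Z/L2_resolvent.
rewrite (funext (transfer_sum u v)) fourier_sum// -mulmxA mxE.
apply: eq_bigr => i _; congr (_ * _); rewrite fourier_sum; last by move=> j; exact: L2_resolvent.
by rewrite mxE; apply: eq_bigr => j _; rewrite mxE mulrC.
Qed.

Lemma H2_transfer u v : H2 (transfer u v).
Proof.
split=> [|m m0]; first exact: L2_transfer.
by rewrite fourier_transfer resolvent_coef_lt0// mulmx0 mul0mx mxE.
Qed.

Lemma transfer_at0 u v : at0 (transfer u v) = (u *m v) 0 0.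
Proof. by rewrite /at0 fourier_transfer resolvent_coef0 mulmx1. Qed.

Lemma transfer_shift u v z : z * z^*%C = 1 ->
  transfer u v z = (u *m v) 0 0 + z * transfer (u *m A) v z.
Proof.
move=> z1; rewrite /transfer {1}(resolventEr z1) mulmxDr mulmxDl mulmx1 mxE; congr (_ + _).
by rewrite -scalemxAr -scalemxAl mxE mulmxA.
Qed.

Lemma transferDl a u u' v z : transfer (a *: u + u') v z = a * transfer u v z + transfer u' v z.
Proof. by rewrite /transfer !mulmxDl -!scalemxAl !mxE. Qed.

(** Put E = 1 - zA.  As |z| = 1, D D^* = 1 - (1 - E)(1 - E)^* = E + E^* - E E^*,
    and B is the inverse of E. *)
Lemma resolvent_isometry z : z * z^*%C = 1 ->
  B z *m D *m adjmx D *m adjmx (B z) = B z + adjmx (B z) - 1%:M.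
Proof.
move=> z1; set E := 1%:M - z *: A.
have zA : z *: A = 1%:M - E by rewrite opprB addrC subrK.
have AA : A *m adjmx A = (z *: A) *m adjmx (z *: A).
  by rewrite adjmxZ -scalemxAl -scalemxAr scalerA z1 scale1r.
have BE : B z *m E = 1%:M by exact: resolventV.
have EB : adjmx E *m adjmx (B z) = 1%:M by rewrite -adjmxM BE adjmx1.
have DD : D *m adjmx D = E + adjmx E - E *m adjmx E.
  have : D *m adjmx D = 1%:M - A *m adjmx A by rewrite -AD1 addrC addKr.
  move=> ->; rewrite AA zA adjmxD adjmxN adjmx1 mulmxBl mul1mx mulmxBr mulmx1.
  by rewrite opprB addrCA opprB [1%:M + _]addrC subrK addrAC.
rewrite -(mulmxA (B z)) DD mulmxBr mulmxDr mulmxBl mulmxDl BE mul1mx.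
by rewrite -[B z *m _ *m _]mulmxA EB mulmx1 !mulmxA BE mul1mx EB [adjmx _ + _]addrC.
Qed.

Lemma transfer_adj u v z :
  (transfer u v z)^*%C = (adjmx v *m adjmx (B z) *m adjmx u) 0 0.
Proof. by rewrite /transfer -adjmxE !adjmxM mulmxA. Qed.

Lemma transfer_col u j z : transfer u (col j D) z = (u *m B z *m D) 0 j.
Proof. by rewrite /transfer !mxE; apply: eq_bigr => k _; rewrite [col j D k 0]mxE. Qed.

Lemma transfer_inner_pointwise u u' z : z * z^*%C = 1 ->
  \sum_j transfer u (col j D) z * (transfer u' (col j D) z)^*%C =
  transfer u (adjmx u') z + (transfer u' (adjmx u) z)^*%C - (u *m adjmx u') 0 0.
Proof.
move=> z1; transitivity ((u *m B z *m D *m adjmx (u' *m B z *m D)) 0 0).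
  by rewrite [RHS]mxE; apply: eq_bigr => j _; rewrite !transfer_col adjmxE.
have -> : u *m B z *m D *m adjmx (u' *m B z *m D) =
    u *m (B z *m D *m adjmx D *m adjmx (B z)) *m adjmx u'.
  by rewrite !adjmxM !mulmxA.
rewrite resolvent_isometry// mulmxBr mulmxDr mulmx1 mulmxBl mulmxDl.
by rewrite transfer_adj adjmxK [LHS]mxE [X in X + _ = _]mxE [X in _ + X = _]mxE.
Qed.

Lemma circle_int_transfer u v : circle_int (transfer u v) = (u *m v) 0 0.
Proof.
rewrite -transfer_at0; apply: eq_circle_int => z _.
by rewrite oppr0 expr0z mulr1.
Qed.

Lemma Linfty_transfer u v : Linfty (transfer u v).
Proof.
rewrite (funext (transfer_sum u v)); apply: circle_continuous_Linfty.
apply: circle_continuous_sum => i; apply: circle_continuousM; first exact: circle_continuous_cst.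
apply: circle_continuous_sum => j; apply: circle_continuousM; first exact: circle_continuous_cst.
exact: resolvent_continuous.
Qed.

(** Integrate the pointwise identity: the mean of B is 1. *)
Lemma inner_transfer u u' :
  \sum_j inner (transfer u (col j D)) (transfer u' (col j D)) = (u *m adjmx u') 0 0.
Proof.
rewrite -circle_int_sum; last first.
  by move=> j; apply: L2M; [exact: Linfty_transfer|exact/L2J/L2_transfer].
transitivity (circle_int (fun z => transfer u (adjmx u') z + ((transfer u' (adjmx u) z)^*%C +
    - (u *m adjmx u') 0 0))).
  by apply: eq_circle_int => z z1; rewrite transfer_inner_pointwise// addrA.
have LT w v := L2_integrable (L2_transfer w v).
have LJ w v := L2_integrable (L2J (L2_transfer w v)).
have Lc c := L2_integrable (L2_cst (c : C)).
rewrite !circle_intD//; last exact: circle_integrableD.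
rewrite circle_intJ// !circle_int_transfer circle_int_cst -adjmxE adjmxM adjmxK.
by rewrite subrr addr0.
Qed.

End Resolvent.

(** * Model spaces of finite Blaschke products *)

Section ModelSpace.
Variable R : realType.
Local Notation C := R[i].

Lemma model_spaceD (f g I : C -> C) (a : C) :
  model_space I f -> model_space I g -> model_space I (fun z => a * f z + g z).
Proof.
move=> [hf [u /conjH20P[hu u0] fu]] [hg [v /conjH20P[hv v0] gv]].
split; first by apply: H2D => //; exact: H2Z.
exists (fun z => a * u z + v z).
  apply/conjH20P; split=> [|m m0]; first by apply: L2D => //; exact: L2Z.
  by rewrite fourierD ?fourierZ ?u0 ?v0 ?mulr0 ?addr0//; exact: L2Z.
by apply: circle_ae2 fu gv => z _ -> ->; rewrite mulrDr mulrCA.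
Qed.

Lemma model_space0 (I : C -> C) : model_space I (fun=> 0).
Proof.
split; first exact: H2_cst.
exists (fun=> 0); first exact: conjH20_0.
by apply: circle_ae_pointwise => z _; rewrite mulr0.
Qed.

End ModelSpace.

Section ScalarModel.
Variable R : realType.
Local Notation C := R[i].
Variables (n : nat) (A : 'M[C]_n) (D : 'cV[C]_n).
Hypothesis AD1 : A *m adjmx A + D *m adjmx D = 1%:M.
Hypothesis unitA : forall z, z * z^*%C = 1 -> 1%:M - z *: A \in unitmx.
Variable b : 'rV[C]_n.
Hypothesis bA : b *m adjmx A = 0.
Hypothesis b1 : (b *m adjmx b) 0 0 = 1.
Implicit Types (f g h : C -> C) (z : C).

Local Notation T u := (transfer A u D).
(** The inner function is itself an element of the space, up to the choice of the
    unit row b: the colligation with rows (A D) and (b 0) is unitary. *)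
Definition blaschke : C -> C := T b.

Lemma col_ord0 : col ord0 D = D.
Proof. by apply/colP => i; rewrite !mxE. Qed.

(** b (1 - zA)^* = b because b A^* = 0. *)
Lemma b_adj_resolvent z : z * z^*%C = 1 -> b *m adjmx (resolvent A z) = b.
Proof.
move=> z1; have /(congr1 (@adjmx R _ _)) := resolventV unitA z1.
rewrite adjmxM adjmx1 adjmxD adjmxN adjmx1 adjmxZ => E.
rewrite -[RHS]mulmx1 -E mulmxA mulmxBr mulmx1 -scalemxAr bA scaler0 subr0.
by [].
Qed.

(** In the isometry identity the terms b B^* x^* and b x^* cancel. *)
Lemma blaschke_mul_transferJ x z : z * z^*%C = 1 ->
  blaschke z * (T x z)^*%C = transfer A b (adjmx x) z.
Proof.
move=> z1; have := transfer_inner_pointwise AD1 unitA b x z1.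
rewrite big_ord1 col_ord0 => ->; rewrite -addrA -[RHS]addr0; congr (_ + _).
by rewrite transfer_adj adjmxK b_adj_resolvent// subrr.
Qed.

Lemma blaschke_mulJ z : z * z^*%C = 1 -> blaschke z * (blaschke z)^*%C = 1.
Proof.
move=> z1; rewrite blaschke_mul_transferJ// /transfer -mulmxA.
have -> : resolvent A z *m adjmx b = adjmx b; last exact: b1.
by rewrite -[in LHS](adjmxK (resolvent A z)) -adjmxM b_adj_resolvent.
Qed.

Lemma inner_function_blaschke : inner_function blaschke.
Proof.
split; first exact: (H2_transfer AD1 unitA).
apply: aeW => t _; apply/eqP; rewrite -sqrp_eq1 ?normc_nneg//.
by have := blaschke_mulJ (cis_mulJ t); rewrite mulc_conjc => -[->].
Qed.

(** By the previous formula, chi z times z^-1 times the conjugate of b B x^* is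
    x B D. *)
Lemma transfer_model_space x : model_space (fun z => blaschke z * z) (T x).
Proof.
split; first exact: (H2_transfer AD1 unitA).
exists (fun z => z ^ (-1) * (transfer A b (adjmx x) z)^*%C).
  apply/conjH20P; split; first exact/L2_expM/L2J/L2_transfer.
  move=> m m0; rewrite fourier_shift opprK fourierJ; last exact: L2_transfer.
  have [_ h] := H2_transfer AD1 unitA b (adjmx x).
  by rewrite h ?conjc0// oppr_lt0 (le_lt_trans m0)// ltrDl.
apply: circle_ae_pointwise => z z1; rewrite -blaschke_mul_transferJ// conjcM conjcK.
rewrite exprN1 mulrA -(mulrA (blaschke z)) mulfV ?circle_neq0// mulr1.
by rewrite mulrA blaschke_mulJ// mul1r.
Qed.

(** By induction on k: T u = u D + z T (uA), and the constant u D contributes a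
    coefficient of f of negative index. *)
Lemma fourier_orth_transfer f u (k : nat) : H2 f -> (forall x, inner f (T x) = 0) ->
  fourier (fun z => f z * (T u z)^*%C) (- k%:Z) = 0.
Proof.
move=> [hf f0] fT; have LT w : L2 (T w) by exact: L2_transfer.
have cc a : Linfty (fun z => (T a z)^*%C) by apply/LinftyJ/Linfty_transfer.
have LfT w : L2 (fun z => f z * (T w z)^*%C).
  by under eq_fun do rewrite mulrC; exact: L2M.
elim: k u => [|k IH] u.
  by rewrite -[RHS](fT u); apply: eq_circle_int => z _; rewrite oppr0 expr0z mulr1.
have -> : fourier (fun z => f z * (T u z)^*%C) (- k.+1%:Z) =
    fourier (fun z => ((u *m D) 0 0)^*%C * f z + z ^ (-1) * (f z * (T (u *m A) z)^*%C)) (- k.+1%:Z).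
  apply: eq_circle_int => z z1; congr (_ * _).
  rewrite transfer_shift// conjcD conjcM -(circle_inv z1) exprN1 mulrDr.
  by rewrite mulrC mulrCA.
rewrite fourierD; [|exact: L2Z|exact: L2_expM].
rewrite fourierZ// f0 ?mulr0 ?add0r; last by rewrite oppr_lt0.
have e : - k.+1%:Z + 1 = - k%:Z :> int by rewrite intS opprD addrAC addNr add0r.
by rewrite fourier_shift opprK e IH.
Qed.

Lemma inner_transfer1 u v : inner (T u) (T v) = (u *m adjmx v) 0 0.
Proof. by have := inner_transfer AD1 unitA u v; rewrite big_ord1 col_ord0. Qed.

Lemma model_space_orth0 f : model_space (fun z => blaschke z * z) f ->
  (forall x, inner f (T x) = 0) -> circle_ae f (fun=> 0).
Proof.
move=> [Hf [h /conjH20P[hh h0] fh]] fT; have hf := Hf.1.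
have Lchi : Linfty blaschke by exact: Linfty_transfer.
pose v z := f z * (blaschke z)^*%C.
have Lv : L2 v by rewrite /v; under eq_fun do rewrite mulrC; exact/L2M/hf/LinftyJ.
have vh : circle_ae v (fun z => z ^ 1 * h z).
  apply: circle_ae1 fh => z z1; rewrite /v => ->.
  by rewrite expr1z -[RHS]mul1r -(blaschke_mulJ z1); ring.
have v0 : circle_ae v (fun=> 0).
  apply: fourier_inj0 => // m; have [m0|m0] := lerP m 0.
    have -> : m = - (`|m|%N)%:Z by rewrite abszE ler0_norm// opprK.
    exact: fourier_orth_transfer.
  rewrite (fourier_ae _ Lv (L2_expM 1 hh) vh) fourier_shift h0//.
  by rewrite subr_ge0.
apply: circle_ae1 v0 => z z1; rewrite /v => vz.
by rewrite -[LHS]mulr1 -(blaschke_mulJ z1) [blaschke z * _]mulrC mulrA vz mul0r.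
Qed.

(** Subtract from f its projection on the space of all T x; the coordinates of the
    projection are the inner products with the T x for x a basis vector. *)
Lemma model_space_blaschke_sub f : model_space (fun z => blaschke z * z) f ->
  exists x, circle_ae f (T x).
Proof.
move=> Mf; have Lf := Mf.1.1; have LT w : L2 (T w) by exact: L2_transfer.
pose x : 'rV[C]_n := \row_i inner f (T (delta_mx 0 i)).
have innT g y : L2 g -> inner g (T y) = \sum_i (y 0 i)^*%C * inner g (T (delta_mx 0 i)).
  by move=> Lg; rewrite (funext (transfer_delta A y D)) inner_sumr.
exists x; have Md := model_spaceD (-1) (transfer_model_space x) Mf.
have : circle_ae (fun z => -1 * T x z + f z) (fun=> 0).
  apply: (model_space_orth0 Md) => y.
  rewrite innerDl ?innerZl//; last exact: L2Z.
  rewrite inner_transfer1 innT// mulN1r addrC; apply/eqP; rewrite subr_eq0; apply/eqP.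
  by rewrite [RHS]mxE; apply: eq_bigr => i _; rewrite adjmxE [x 0 i]mxE mulrC.
by apply: circle_ae1 => z _ /eqP; rewrite mulN1r addrC subr_eq0 => /eqP.
Qed.

End ScalarModel.

(** * Finite-dimensional nearly invariant spaces *)

Section FiniteDim.
Variable R : realType.
Local Notation C := R[i].
Implicit Types (f g h : C -> C) (z : C) (X M N : set (C -> C)).

(** Spaces of functions, not of classes: spans and projections below are taken
    up to almost-everywhere equality. *)
Definition L2_subspace X : Prop :=
  [/\ forall f, X f -> L2 f, X (fun=> 0) &
      forall (a : C) f g, X f -> X g -> X (fun z => a * f z + g z)].

Lemma L2_subspace_sum X (I : Type) (r : seq I) (c : I -> C) (F : I -> C -> C) :
  L2_subspace X -> (forall i, X (F i)) -> X (fun z => \sum_(i <- r) c i * F i z).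
Proof.
move=> [_ X0 XD] XF; elim: r => [|i r IH].
  by under eq_fun do rewrite big_nil.
by under eq_fun do rewrite big_cons; exact: XD.
Qed.

Lemma L2_subspaceB X f g : L2_subspace X -> X f -> X g -> X (fun z => f z - g z).
Proof.
move=> [_ _ XD] Xf Xg; rewrite (_ : (fun z => _) = fun z => -1 * g z + f z); first exact: XD.
by apply/funext => z; rewrite mulN1r addrC.
Qed.

Lemma orthonormal_comb_eq0 m (e : 'I_m -> C -> C) (x : 'rV[C]_m) :
  (forall i, L2 (e i)) -> is_orthonormal e ->
  circle_ae (fun z => \sum_i x 0 i * e i z) (fun=> 0) -> x = 0.
Proof.
move=> he oe x0; have hx : L2 (fun z => \sum_i x 0 i * e i z).
  by apply: L2_sum => i; exact: L2Z.
apply: mulmx_adj_eq0; apply/matrixP => i j; rewrite !ord1 [RHS]mxE mxE.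
under eq_bigr do rewrite adjmxE.
rewrite -(orthonormal_inner (fun i => x 0 i) (fun i => x 0 i) he oe).
rewrite (inner_ae hx (L2_cst 0) hx hx x0 (circle_ae_refl _)).
exact: inner0l.
Qed.

(** More orthonormal vectors than generators would satisfy a linear relation. *)
Lemma orthonormal_size_le k m (v : 'I_k -> C -> C) (e : 'I_m -> C -> C) :
  (forall i, L2 (e i)) -> is_orthonormal e ->
  (forall i, exists c : 'I_k -> C, circle_ae (e i) (fun z => \sum_j c j * v j z)) ->
  (m <= k)%N.
Proof.
move=> he oe /choice[c hc]; rewrite leqNgt; apply/negP => km.
pose A := \matrix_(i < m, j < k) c i j.
have /nonfree_kernel[x x0 xA] : ~~ row_free A.
  by rewrite /row_free neq_ltn (leq_ltn_trans (rank_leq_col A) km).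
move/eqP: x0; apply; apply: (orthonormal_comb_eq0 he oe).
apply: (@circle_ae_trans _ (fun z => \sum_i x 0 i * \sum_j c i j * v j z)).
  by apply: circle_ae_sum => i; apply: circle_ae1 (hc i) => z _ ->.
apply: circle_ae_pointwise => z _; under eq_bigr do rewrite big_distrr /=.
rewrite exchange_big big1//= => j _.
under eq_bigr do rewrite mulrA; rewrite -big_distrl /=.
suff -> : \sum_i x 0 i * c i j = 0 by rewrite mul0r.
transitivity ((x *m A) 0 j); last by rewrite xA mxE.
by rewrite mxE; apply: eq_bigr => i _; rewrite mxE.
Qed.

Lemma orthonormal_extend m (e : 'I_m -> C -> C) d :
  (forall i, L2 (e i)) -> is_orthonormal e -> L2 d ->
  (forall i, inner d (e i) = 0) -> inner d d = 1 ->
  is_orthonormal (fun i : 'I_m.+1 => if unlift ord_max i is Some j then e j else d).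
Proof.
move=> he oe hd de dd i j; case: unliftP => [i' ->|->]; case: unliftP => [j' ->|->].
- by rewrite oe (inj_eq (@lift_inj _ _)).
- by rewrite innerC// de conjc0 eq_sym (negPf (neq_lift _ _)).
- by rewrite de (negPf (neq_lift _ _)).
- by rewrite eqxx dd.
Qed.

(** Gram-Schmidt, by maximality: an orthonormal family of X of largest size. *)
Lemma orthonormal_basis k X (v : 'I_k -> C -> C) : L2_subspace X ->
  (forall f, X f -> exists c : 'I_k -> C, circle_ae f (fun z => \sum_j c j * v j z)) ->
  exists m (e : 'I_m -> C -> C),
    [/\ forall i, X (e i), is_orthonormal e & forall f, X f -> circle_ae f (orth_proj e f)].
Proof.
move=> SX Xv; have [XL X0 XD] := SX.
pose P m := `[< exists e : 'I_m -> C -> C, (forall i, X (e i)) /\ is_orthonormal e >].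
have exP : exists m, P m.
  by exists 0; apply/asboolP; exists (fun _ _ => 0); split=> [[]|[]].
have leP m : P m -> (m <= k)%N.
  move=> /asboolP[e [Xe oe]]; apply: (@orthonormal_size_le _ _ v e) => //.
    by move=> i; exact: XL.
  by move=> i; exact: Xv.
have [m /asboolP[e [Xe oe]] mmax] := ex_maxnP exP leP.
exists m, e; split=> // f Xf; have he i : L2 (e i) by exact: XL.
have hf := XL _ Xf.
pose d z := f z - orth_proj e f z.
have Xd : X d by apply: L2_subspaceB => //; exact: L2_subspace_sum.
have hd := XL _ Xd.
have de i : inner d (e i) = 0.
  by rewrite innerBl ?inner_orth_proj_basis ?subrr//; exact: L2_orth_proj.
have [dd|dd] := eqVneq (inner d d) 0.
  by apply: circle_ae1 (inner_eq0 hd dd) => z _ /eqP; rewrite subr_eq0 => /eqP.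
have r0 : 0 < Re (inner d d).
  rewrite lt_neqAle inner_self_ge0 andbT; apply: contraNneq dd => r.
  by rewrite inner_self -r.
pose s : C := (Num.sqrt (Re (inner d d)))^-1%:C.
have Xs : X (fun z => s * d z).
  rewrite (_ : (fun z => _) = fun z => s * d z + 0); first exact: XD.
  by apply/funext => z; rewrite addr0.
have : P m.+1.
  apply/asboolP; exists (fun i => if unlift ord_max i is Some j then e j else fun z => s * d z).
  split=> [i|]; first by case: unliftP.
  apply: orthonormal_extend => //; first exact: L2Z.
    by move=> i; rewrite innerZl// de mulr0.
  rewrite innerZl ?innerZr//; last exact: L2Z.
  rewrite /s conjc_real inner_self -!(rmorphM (real_complex R)) mulrA -expr2 exprVn.
  by rewrite sqr_sqrtr ?inner_self_ge0// mulVf// gt_eqF.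
by move=> /mmax; rewrite ltnn.
Qed.

Variables (M N : set (C -> C)).
Hypothesis SM : L2_subspace M.
Hypothesis SN : L2_subspace N.
Hypothesis NM : N `<=` M.
Hypothesis MH : forall f, M f -> H2 f.
Hypothesis Ndiv : forall f, N f -> exists2 h, M h & circle_ae f (fun z => z * h z).
Variables (k : nat) (v : 'I_k -> C -> C).
Hypothesis Mv : forall f, M f ->
  exists c : 'I_k -> C, circle_ae f (fun z => \sum_j c j * v j z).
Variables (p : nat) (w : 'I_p -> C -> C).
Hypothesis Ww : forall j, orth_diff M N (w j).
Hypothesis ow : is_orthonormal w.
Hypothesis wspan : forall f, orth_diff M N f -> circle_ae f (orth_proj w f).

(** Remove from f its projections on W and then on N: what is left belongs to W
    and is orthogonal to W. *)
Lemma nearly_invariant_decomp f : M f -> exists2 c, N c & circle_ae f (fun z => orth_proj w f z + c z).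
Proof.
move=> Mf; have [ML _ _] := SM; have [NL _ _] := SN.
have Mw j : M (w j) by case: (Ww j).
have hw j := ML _ (Mw j); have hf := ML _ Mf.
have [m [e [Ne oe esp]]] := orthonormal_basis SN (fun f Nf => Mv (NM Nf)).
have he i := NL _ (Ne i).
pose g z := f z - orth_proj w f z.
have Mg : M g by apply: L2_subspaceB => //; exact: L2_subspace_sum.
have hg := ML _ Mg.
have Npg : N (orth_proj e g) by exact: L2_subspace_sum.
have hpg := NL _ Npg.
pose g' z := g z - orth_proj e g z.
have Mg' : M g' by apply: L2_subspaceB => //; exact: NM.
have hg' := ML _ Mg'.
have Wg' : orth_diff M N g'.
  split=> // h Nh; have hh := NL _ Nh.
  rewrite (inner_ae hg' hg' hh (L2_orth_proj h he) (circle_ae_refl _) (esp _ Nh)).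
  rewrite inner_sumr// big1// => i _.
  by rewrite innerBl// inner_orth_proj_basis// subrr mulr0.
have g'0 : circle_ae g' (fun=> 0).
  apply: circle_ae_trans (wspan Wg') _; apply: circle_ae_pointwise => z _.
  apply: big1 => j _; rewrite innerBl// innerBl//; last exact: L2_orth_proj.
  rewrite inner_orth_proj_basis// subrr sub0r innerC// (Ww j).2//.
  by rewrite conjc0 oppr0 mul0r.
exists (orth_proj e g) => //; apply: circle_ae1 g'0 => z _ /eqP.
by rewrite /g' /g !subr_eq0 subr_eq addrC => /eqP.
Qed.

(** The Gram matrix of e is computed from the orthogonal decomposition of each e_i
    into a part in W and z times an element of M. *)
Lemma nearly_invariant_realization : exists n (e : 'I_n -> C -> C) (A : 'M[C]_n) (D : 'M[C]_(n, p)),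
  [/\ (forall i, M (e i)) /\ is_orthonormal e,
      forall f, M f -> circle_ae f (orth_proj e f),
      forall i j, D i j = inner (e i) (w j),
      A *m adjmx A + D *m adjmx D = 1%:M &
      forall i, circle_ae (e i) (fun z => \sum_j D i j * w j z + z * \sum_l A i l * e l z)].
Proof.
have [ML _ _] := SM; have [NL _ _] := SN.
have Mw j : M (w j) by case: (Ww j).
have hw j := ML _ (Mw j).
have [n [e [Me oe esp]]] := orthonormal_basis SM Mv.
have he i := ML _ (Me i).
have /choice[c_ hc] : forall i, exists ch : (C -> C) * (C -> C),
    [/\ N ch.1, M ch.2, circle_ae (e i) (fun z => orth_proj w (e i) z + ch.1 z) &
        circle_ae ch.1 (fun z => z * ch.2 z)].
  move=> i; have [c Nc ec] := nearly_invariant_decomp (Me i); have [h Mh ch] := Ndiv Nc.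
  by exists (c, h).
pose A := \matrix_(i < n, l < n) inner (c_ i).2 (e l).
pose D := \matrix_(i < n, j < p) inner (e i) (w j).
have cA i : circle_ae (c_ i).1 (fun z => z * \sum_l A i l * e l z).
  have [_ Mh _ ch] := hc i; apply: circle_ae2 ch (esp _ Mh) => z _ -> ->.
  by congr (_ * _); apply: eq_bigr => l _; rewrite mxE.
have wD i z : orth_proj w (e i) z = \sum_j D i j * w j z.
  by apply: eq_bigr => j _; rewrite mxE.
exists n, e, A, D; split=> //; [by move=> i j; rewrite mxE| |]; last first.
  by move=> i; have [_ _ ec _] := hc i; apply: circle_ae2 ec (cA i) => z _ -> ->; rewrite wD.
apply/matrixP => i l; rewrite [RHS]mxE -oe [LHS]mxE.
have hD i' : L2 (fun z => \sum_j D i' j * w j z) by apply: L2_sum => j; exact: L2Z.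
have hA i' : L2 (fun z => \sum_l A i' l * e l z) by apply: L2_sum => j; exact: L2Z.
have hcc i' : L2 (c_ i').1 by have [Nc _ _ _] := hc i'; exact: NL.
have hs i' : L2 (fun z => \sum_j D i' j * w j z + (c_ i').1 z) by exact: L2D.
have es i' : circle_ae (e i') (fun z => \sum_j D i' j * w j z + (c_ i').1 z).
  by have [_ _ ec _] := hc i'; apply: circle_ae1 ec => z _ ->; rewrite wD.
have Dc i1 i2 : inner (fun z => \sum_j D i1 j * w j z) (c_ i2).1 = 0.
  have [Nc _ _ _] := hc i2.
  by rewrite inner_suml// big1// => j _; rewrite (Ww j).2// mulr0.
rewrite (inner_ae (he i) (hs i) (he l) (hs l) (es i) (es l)).
rewrite innerDl// !innerDr// Dc addr0 [X in _ = _ + (X + _)]innerC// Dc conjc0 add0r.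
rewrite orthonormal_inner// addrC; congr (_ + _).
  by rewrite mxE; apply: eq_bigr => j _; rewrite adjmxE.
have hzA i' : L2 (fun z => z * \sum_l A i' l * e l z) by exact: (L2_expM 1).
rewrite (inner_ae (hcc i) (hzA i) (hcc l) (hzA l) (cA i) (cA l)).
transitivity (inner (fun z => \sum_l A i l * e l z) (fun z => \sum_k A l k * e k z)).
  by rewrite orthonormal_inner// mxE; apply: eq_bigr => j _; rewrite adjmxE.
apply: eq_circle_int => z z1; rewrite conjcM.
by rewrite mulrACA z1 mul1r.
Qed.

End FiniteDim.

(** * Factorisation through the resolvent *)

Section Realization.
Variable R : realType.
Local Notation C := R[i].
Implicit Types (f g h : C -> C) (z : C).
Variables (n p : nat) (e : 'I_n -> C -> C) (w : 'I_p -> C -> C).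
Variables (A : 'M[C]_n) (D : 'M[C]_(n, p)).
Hypothesis He : forall i, H2 (e i).
Hypothesis oe : is_orthonormal e.
Hypothesis AD1 : A *m adjmx A + D *m adjmx D = 1%:M.
Hypothesis rel : forall i,
  circle_ae (e i) (fun z => \sum_j D i j * w j z + z * \sum_l A i l * e l z).

Definition comb (x : 'rV[C]_n) : C -> C := fun z => \sum_i x 0 i * e i z.

(** The relation between e and w, for coefficients that may depend on z: the
    resolvent will be substituted for them. *)
Lemma comb_rel (y : C -> 'rV[C]_n) :
  circle_ae (fun z => comb (y z) z)
    (fun z => \sum_j (y z *m D) 0 j * w j z + z * comb (y z *m A) z).
Proof.
apply: (@circle_ae_trans _ (fun z => \sum_i y z 0 i *
    (\sum_j D i j * w j z + z * \sum_l A i l * e l z))).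
  by apply: circle_ae_sum => i; apply: circle_ae1 (rel i) => z _ <-.
apply: circle_ae_pointwise => z _; under eq_bigr do rewrite mulrDr; rewrite big_split /=.
congr (_ + _).
  under eq_bigr do rewrite big_distrr /=; rewrite exchange_big /=.
  apply: eq_bigr => j _; under eq_bigr do rewrite mulrA.
  by rewrite -big_distrl mxE.
under eq_bigr do rewrite mulrCA; rewrite -big_distrr /=; congr (_ * _).
under eq_bigr do rewrite big_distrr /=; rewrite exchange_big /=.
apply: eq_bigr => j _; under eq_bigr do rewrite mulrA.
by rewrite -big_distrl mxE.
Qed.

Lemma combZ a x z : comb (a *: x) z = a * comb x z.
Proof. by rewrite /comb big_distrr /=; apply: eq_bigr => i _; rewrite mxE mulrA. Qed.

Lemma combB x y z : comb (x - y) z = comb x z - comb y z.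
Proof.
by rewrite /comb -sumrB; apply: eq_bigr => i _; rewrite !mxE mulrBl.
Qed.

Lemma H2_comb x : H2 (comb x).
Proof. by apply: H2_sum => i; exact: H2Z. Qed.

(** If x = z0 xA then |xA| = |x|, hence xD = 0 and F = x e satisfies
    F = conj(z0) z F; its coefficients obey a one-term recursion. *)
Lemma realization_unit z0 : z0 * z0^*%C = 1 -> 1%:M - z0 *: A \in unitmx.
Proof.
move=> z1; rewrite -row_free_unit; apply/negPn/negP => /nonfree_kernel[x x0].
rewrite mulmxBr mulmx1 -scalemxAr => /eqP; rewrite subr_eq0 => /eqP xA.
have xA' : x *m A = z0^*%C *: x.
  by rewrite {2}xA scalerA mulrC z1 scale1r.
have xD : x *m D = 0.
  apply: mulmx_adj_eq0.
  have := mulmx_adj_split x AD1.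
  rewrite {1}xA' adjmxM -(adjmxM x A) xA' adjmxZ conjcK -scalemxAl -scalemxAr scalerA.
  by rewrite mulrC z1 scale1r => /eqP; rewrite -subr_eq0 opprD addrA subrr sub0r oppr_eq0 => /eqP.
have [hF F0] := H2_comb x.
have F1 : circle_ae (comb x) (fun z => z0^*%C * (z ^ 1 * comb x z)).
  have := comb_rel (fun=> x); rewrite xD xA'; apply: circle_ae1 => z _ E.
  rewrite {1}E big1 ?add0r ?combZ ?expr1z 1?mulrCA// => j _.
  by rewrite mxE mul0r.
have Frec m : fourier (comb x) m = z0^*%C * fourier (comb x) (m - 1).
  have hz : L2 (fun z => z ^ 1 * comb x z) by exact: L2_expM.
  by rewrite {1}(fourier_ae _ hF (L2Z _ hz) F1) fourierZ// fourier_shift.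
move/eqP: x0; apply; apply: (orthonormal_comb_eq0 (e := e)) => //.
  by move=> i; case: (He i).
apply: fourier_inj0 => // m; case: m => m; last exact: F0.
elim: m => [|m IH]; first by rewrite Frec F0 ?mulr0.
by rewrite Frec (_ : m.+1%:Z - 1 = m) ?IH ?mulr0// intS addrC addKr.
Qed.

(** Take y = x B(z) in [comb_rel] and use y - z yA = x. *)
Lemma comb_transfer x :
  circle_ae (comb x) (fun z => \sum_j w j z * transfer A x (col j D) z).
Proof.
apply: circle_ae1 (comb_rel (fun z => x *m resolvent A z)) => z z1 E.
have xE : x = x *m resolvent A z - z *: (x *m resolvent A z *m A).
  rewrite scalemxAr -[X in X - _]mulmx1 -mulmxBr -mulmxA.
  by rewrite (resolventV realization_unit z1) mulmx1.
rewrite {1}xE combB combZ E addrK.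
by apply: eq_bigr => j _; rewrite transfer_col mulrC.
Qed.

End Realization.

(** * The kernel of a dual truncated Toeplitz operator *)

Section Kernel.
Variable R : realType.
Local Notation C := R[i].
Implicit Types (f h : C -> C) (z : C).
Variables (theta g : C -> C).
Hypothesis g_bounded : Linfty g.

Local Notation ker := (ker_dual_TTO theta g).
Local Notation gker := (mul_set g (ker_dual_TTO theta g)).
Local Notation gC := (mul_set g (setC_of theta g)).

Lemma conjH20_plusD (X : set (C -> C)) f h (a : C) :
  (forall u v, X u -> X v -> X (fun z => a * u z + v z)) ->
  conjH20_plus theta X f -> conjH20_plus theta X h ->
  conjH20_plus theta X (fun z => a * f z + h z).
Proof.
move=> XD [hf [v [u [cv Xu fE]]]] [hh [v' [u' [cv' Xu' hE]]]].
split; first by apply: L2D => //; exact: L2Z.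
exists (fun z => a * v z + v' z), (fun z => a * u z + u' z); split.
- exact: conjH20D.
- exact: XD.
- by apply: circle_ae2 fE hE => z _ -> ->; ring.
Qed.

Lemma conjH20_plus0 (X : set (C -> C)) : X (fun=> 0) -> conjH20_plus theta X (fun=> 0).
Proof.
move=> X0; split; first exact: L2_cst.
exists (fun=> 0), (fun=> 0); split; [exact: conjH20_0|exact: X0|].
by apply: circle_ae_pointwise => z _; rewrite mulr0 addr0.
Qed.

Lemma Kperp0 : Kperp theta (fun=> 0).
Proof. by apply: conjH20_plus0; exact: H2_cst. Qed.

Lemma kerP f : ker f <-> Kperp theta f /\
  forall h, Kperp theta h -> inner (fun z => g z * f z) h = 0.
Proof.
have E h : inner (fun z => g z * f z - 0) h = inner (fun z => g z * f z) h.
  by apply: eq_circle_int => z _; rewrite subr0.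
split=> [[Kf [_ K]]|[Kf K]]; split=> //; first by move=> h /K; rewrite E.
by split=> [|h /K]; [exact: Kperp0|rewrite E].
Qed.

Lemma L2_gker f : Kperp theta f -> L2 (fun z => g z * f z).
Proof. by move=> [hf _]; exact: L2M. Qed.

Lemma kerD f h (a : C) : ker f -> ker h -> ker (fun z => a * f z + h z).
Proof.
move=> /kerP[Kf f0] /kerP[Kh h0]; apply/kerP; split.
  by apply: conjH20_plusD => // u v Hu Hv; apply: H2D => //; exact: H2Z.
move=> w Kw; have hw : L2 w by case: Kw.
have gf := L2_gker Kf; have gh := L2_gker Kh.
transitivity (inner (fun z => a * (g z * f z) + g z * h z) w).
  by apply: eq_circle_int => z _; ring.
by rewrite innerDl ?innerZl ?f0 ?h0 ?mulr0 ?addr0//; exact: L2Z.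
Qed.

Lemma ker0 : ker (fun=> 0).
Proof.
apply/kerP; split=> [|h Kh]; first exact: Kperp0.
rewrite -[RHS](inner0l h).
by apply: eq_circle_int => z _; rewrite mulr0.
Qed.

Lemma L2_subspace_mul_set X : X (fun=> 0) -> (forall f, X f -> L2 f) ->
  (forall a f h, X f -> X h -> X (fun z => a * f z + h z)) -> L2_subspace (mul_set g X).
Proof.
move=> X0 XL XD; split.
- by move=> _ [f Xf <-]; apply: L2M => //; exact: XL.
- by exists (fun=> 0) => //; apply/funext => z; rewrite mulr0.
- move=> a _ _ [f Xf <-] [h Xh <-]; exists (fun z => a * f z + h z); first exact: XD.
  by apply/funext => z; ring.
Qed.

Lemma ker_L2 f : ker f -> L2 f.
Proof. by move=> /kerP[[]]. Qed.

Lemma L2_subspace_gker : L2_subspace gker.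
Proof.
apply: L2_subspace_mul_set; [exact: ker0|exact: ker_L2|].
by move=> a f h; exact: kerD.
Qed.

Lemma gker_H2 f : gker f -> H2 f.
Proof.
move=> [h /kerP[Kh h0] <-]; split; first exact: L2_gker.
move=> m m0; rewrite fourierE h0//; split; first exact: L2_exp.
exists (fun z => z ^ m), (fun=> 0); split.
- apply/conjH20P; split=> [|k k0]; first exact: L2_exp.
  by rewrite fourier_exp (lt_eqF (lt_le_trans m0 k0)).
- exact: H2_cst.
- by apply: circle_ae_pointwise => z _; rewrite mulr0 addr0.
Qed.

Lemma L2_subspace_gC : L2_subspace gC.
Proof.
have g0 : (fun z => g z * 0) = (fun=> 0) by apply/funext => z; rewrite mulr0.
apply: L2_subspace_mul_set.
- split; first by split; [exact: ker0|apply: conjH20_plus0; exact: zH2_0].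
  split; first exact: ker0.
  by rewrite g0; split; [exact: model_space0|exact: zH2_0].
- by move=> f [[/ker_L2]].
- move=> a f h [[kf cf] [_ [mf zf]]] [[kh ch] [_ [mh zh]]].
  have gE : (fun z => g z * (a * f z + h z)) = (fun z => a * (g z * f z) + g z * h z).
    by apply/funext => z; ring.
  split; first split; [exact: kerD| |].
    by apply: conjH20_plusD => // u v; exact: zH2D.
  split; first exact: kerD.
  by rewrite gE; split; [exact: model_spaceD|exact: zH2D].
Qed.

Lemma gC_sub_gker : gC `<=` gker.
Proof. by move=> _ [f [[kf _] _] <-]; exists f. Qed.

(** The antianalytic part v of h acquires under multiplication by z a constant
    term, the coefficient of v of index -1; the analytic part gains a zero. *)
Lemma Kperp_mulX h : Kperp theta h ->
  exists a : C, Kperp theta (fun z => z ^ 1 * h z - a).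
Proof.
move=> [hh [v [u [/conjH20P[hv v0] Hu hE]]]].
exists (fourier v (-1)).
have Lzv : L2 (fun z => z ^ 1 * v z) by exact: L2_expM.
split; first by apply: L2B; [exact: L2_expM|exact: L2_cst].
exists (fun z => z ^ 1 * v z - fourier v (-1)), (fun z => z ^ 1 * u z); split.
- apply/conjH20P; split=> [|m m0]; first by apply: L2B => //; exact: L2_cst.
  rewrite fourierB//; last exact: L2_cst.
  rewrite fourier_shift fourier_cst.
  have [->|mn0] := eqVneq m 0; first by rewrite sub0r mulr1 subrr.
  by rewrite v0 ?mulr0 ?subrr// subr_ge0 -gtz0_ge1 lt_neqAle eq_sym mn0.
- case: Hu => hu u0; split=> [|m m0]; first exact: L2_expM.
  by rewrite fourier_shift u0// subr_lt0 (lt_trans m0).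
- by apply: circle_ae1 hE => z _ ->; ring.
Qed.

(** For f = gc, test g c / z against h in the complement of the model space: this
    is gc against zh, where zh is in that complement up to a constant, and gc is
    orthogonal to both. *)
Lemma gC_division f : gC f -> exists2 h, gker h & circle_ae f (fun z => z * h z).
Proof.
move=> [c [[kc cc] [_ [_ /zH2P[_ z0]]]] <-].
have hc := ker_L2 kc; have /kerP[_ c0] := kc.
have Kc' : Kperp theta (fun z => z ^ (-1) * c z).
  case: cc => _ [v [u [/conjH20P[hv v0] [hu [u1 Hu1 uE]] cE]]].
  split; first exact: L2_expM.
  exists (fun z => z ^ (-1) * v z), u1; split=> //.
    apply/conjH20P; split=> [|m m0]; first exact: L2_expM.
    by rewrite fourier_shift opprK v0// addr_ge0.
  apply: circle_ae2 cE uE => z /circle_neq0 zn0 -> ->.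
  by rewrite exprN1 mulrDr; congr (_ + _); rewrite mulrCA (mulrA z^-1) mulVf// mul1r.
exists (fun z => g z * (z ^ (-1) * c z)); last first.
  apply: circle_ae_pointwise => z /circle_neq0 zn0.
  by rewrite mulrCA (mulrA z) exprN1 mulfV// mul1r.
exists (fun z => z ^ (-1) * c z) => //; apply/kerP; split=> // h Kh.
have hh : L2 h by case: Kh.
have gc : L2 (fun z => g z * c z) by exact: L2M.
have [a Ka] := Kperp_mulX Kh.
have hz : L2 (fun z => z ^ 1 * h z) by exact: L2_expM.
transitivity (inner (fun z => g z * c z) (fun z => (z ^ 1 * h z - a) + a)).
  apply: eq_circle_int => z z1; rewrite subrK expr1z conjcM exprN1 circle_inv//; ring.
rewrite innerDr//; [|by apply: L2B => //; exact: L2_cst|exact: L2_cst].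
rewrite c0// add0r; transitivity (inner (fun z => g z * c z) (fun z => a * z ^ 0)).
  by apply: eq_circle_int => z _; rewrite expr0z mulr1.
by rewrite innerZr//; [rewrite -fourierE z0// mulr0|exact: L2_exp].
Qed.

End Kernel.

(** * Parametrisation of the kernel *)

Section Parametrization.
Variable R : realType.
Local Notation C := R[i].
Implicit Types (f g h : C -> C) (z : C).

Lemma basis_orth_proj p (W : set (C -> C)) (e : 'I_p -> C -> C) :
  (forall i, L2 (e i)) -> is_orthonormal e -> is_basis W e ->
  (forall f, W f -> L2 f) -> forall f, W f -> circle_ae f (orth_proj e f).
Proof.
move=> he oe [We sp _] WL f Wf; have [c fc] := sp _ Wf; have hf := WL _ Wf.
have hc : L2 (fun z => \sum_i c i * e i z) by apply: L2_sum => i; exact: L2Z.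
apply: (circle_ae_trans fc); apply: circle_ae_pointwise => z _; apply: eq_bigr => i _.
congr (_ * _); rewrite (inner_ae hf hc (he i) (he i) fc (circle_ae_refl _)).
rewrite inner_suml// (bigD1 i)//= oe eqxx mulr1 big1 ?addr0// => j ji.
by rewrite oe (negPf ji) mulr0.
Qed.

Variables (theta g : C -> C).
Hypothesis g_bounded : Linfty g.
Hypothesis ker_fin : finite_dim (ker_dual_TTO theta g).

Local Notation ker := (ker_dual_TTO theta g).
Local Notation gker := (mul_set g (ker_dual_TTO theta g)).
Local Notation gC := (mul_set g (setC_of theta g)).
Local Notation W := (orth_diff gker gC).

Lemma gker_L2 f : gker f -> L2 f.
Proof. by case: (L2_subspace_gker theta g_bounded) => h _ _; exact: h. Qed.

(** The value of xD identifies the coordinates of an element of W, which is how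
    the one-dimensional case sees that A is singular. *)
Lemma gker_parametrization p (w : 'I_p -> C -> C) :
  (forall j, W (w j)) -> is_orthonormal w ->
  (forall f, W f -> circle_ae f (orth_proj w f)) ->
  exists n (A : 'M[C]_n) (D : 'M[C]_(n, p)),
  [/\ A *m adjmx A + D *m adjmx D = 1%:M,
      forall z, z * z^*%C = 1 -> 1%:M - z *: A \in unitmx,
      forall f, gker f -> exists2 x : 'rV[C]_n,
        circle_ae f (fun z => \sum_j w j z * transfer A x (col j D) z) &
        (x *m D) = \row_j inner f (w j),
      forall x, exists2 f, gker f &
        circle_ae f (fun z => \sum_j w j z * transfer A x (col j D) z) &
      forall f x, gker f ->
        circle_ae f (fun z => \sum_j w j z * transfer A x (col j D) z) ->
        inner f f = (x *m adjmx x) 0 0].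
Proof.
move=> Ww ow wsp; have [d [v [_ vsp _]]] := ker_fin.
have Mv f : gker f -> exists c : 'I_d -> C,
    circle_ae f (fun z => \sum_j c j * (g z * v j z)).
  move=> [h kh <-]; have [c hc] := vsp _ kh; exists c.
  apply: circle_ae1 hc => z _ ->; rewrite big_distrr /=.
  by apply: eq_bigr => j _; rewrite mulrCA.
have SM := L2_subspace_gker theta g_bounded.
have [n [e [A [D [[Me oe] esp DE AD1 rel]]]]] := nearly_invariant_realization SM
  (L2_subspace_gC theta g_bounded) (@gC_sub_gker _ theta g)
  (gC_division g_bounded) Mv Ww ow wsp.
have He i : H2 (e i) by exact: (gker_H2 g_bounded (Me i)).
have he i : L2 (e i) by case: (He i).
have unitA := realization_unit He oe AD1 rel.
have ct := comb_transfer He oe AD1 rel.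
have combM x : gker (comb e x) by exact: L2_subspace_sum.
have hT x : L2 (fun z => \sum_j w j z * transfer A x (col j D) z).
  apply: L2_sum => j; under eq_fun do rewrite mulrC; apply: L2M.
    exact: Linfty_transfer.
  by case: (Ww j) => /gker_L2.
exists n, A, D; split=> //.
- move=> f Mf; have hf := gker_L2 Mf.
  have wf j : L2 (w j) by case: (Ww j) => /gker_L2.
  exists (\row_i inner f (e i)).
    apply: circle_ae_trans (esp _ Mf) _; apply: circle_ae_trans (ct _).
    by apply: circle_ae_pointwise => z _; apply: eq_bigr => i _; rewrite mxE.
  apply/rowP => j; rewrite !mxE.
  rewrite (inner_ae hf (L2_orth_proj f he) (wf j) (wf j) (esp _ Mf) (circle_ae_refl _)).
  rewrite inner_suml//; apply: eq_bigr => i _; by rewrite mxE DE.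
- by move=> x; exists (comb e x).
- move=> f x Mf fx; have hf := gker_L2 Mf; have hx := gker_L2 (combM x).
  have fc : circle_ae f (comb e x) by apply: circle_ae_trans fx (circle_ae_sym (ct x)).
  rewrite (inner_ae hf hx hf hx fc fc) orthonormal_inner// mxE.
  by apply: eq_bigr => i _; rewrite adjmxE.
Qed.

End Parametrization.

(** * The space of coefficient pairs *)

Lemma sum_sqr_le0 (R : realType) (a b : R) :
  a ^+ 2 + b ^+ 2 <= 0 -> a ^+ 2 = 0 /\ b ^+ 2 = 0.
Proof. by have := sqr_ge0 a; have := sqr_ge0 b; split; lra. Qed.

Lemma inner_self_sub (R : realType) (d t : R[i] -> R[i]) : L2 d -> L2 t ->
  inner (fun z => -1 * d z + t z) (fun z => -1 * d z + t z) =
  inner d d + inner t t - inner d t - (inner d t)^*%C.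
Proof.
move=> hd ht; have h1 : L2 (fun z => -1 * d z) by exact: L2Z.
have h2 : L2 (fun z => -1 * d z + t z) by exact: L2D.
rewrite (innerDl h1 ht h2) (innerDr h1 ht h1) (innerDr h1 ht ht).
rewrite (innerZl _ hd h1) (innerZr _ hd hd) (innerZl _ hd ht) (innerZr _ hd ht) -(innerC ht hd).
have -> : (-1 : R[i])^*%C = -1 by apply/eqP; rewrite eq_complex /= !oppr0 !eqxx.
by move: (inner d d) (inner t t) (inner d t) (inner t d) => a b c e; ring.
Qed.

Section PairSpace.
Variable R : realType.
Local Notation C := R[i].
Variables (n : nat) (A : 'M[C]_n) (D : 'M[C]_(n, 2)).
Hypothesis AD1 : A *m adjmx A + D *m adjmx D = 1%:M.
Hypothesis unitA : forall z, z * z^*%C = 1 -> 1%:M - z *: A \in unitmx.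
Implicit Types (z : C) (x y : 'rV[C]_n).

Local Notation T1 x := (transfer A x (col ord0 D)).
Local Notation T2 x := (transfer A x (col (lift ord0 ord0) D)).

(** Membership is required up to almost-everywhere equality, as closedness for
    constant sequences demands. *)
Definition pair_space : set ((C -> C) * (C -> C)) :=
  [set k | H2v k /\ exists x, circle_ae k.1 (T1 x) /\ circle_ae k.2 (T2 x)].

Lemma inner_pair x y : inner (T1 x) (T1 y) + inner (T2 x) (T2 y) = (x *m adjmx y) 0 0.
Proof. by rewrite -(inner_transfer AD1 unitA) big_ord_recl big_ord1. Qed.

Lemma normL2_pair x :
  normL2 (T1 x) ^+ 2 + normL2 (T2 x) ^+ 2 = Re ((x *m adjmx x) 0 0).
Proof.
have <- := congr1 (@complex.Re R) (inner_pair x x).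
by move: (T1 x) (T2 x) => t1 t2; rewrite Re_addc !normL2_sq.
Qed.

(** The parametrisation is isometric, so the limit l has an orthogonal projection
    on the space; the distance from l to the projection is at most the distance
    to any k_m, hence zero. *)
Lemma pair_space_closed : closed_subspace_H2v pair_space.
Proof.
have LT x v : L2 (transfer A x v) by exact: L2_transfer.
have HT x v : H2 (transfer A x v) by exact: (H2_transfer AD1 unitA).
split.
- by move=> k [].
- split; first by split; exact: H2_cst.
  by exists 0; split; apply: circle_ae_pointwise => z _; rewrite /transfer !mul0mx mxE.
- move=> a k l [[k1 k2] [x [kx1 kx2]]] [[l1 l2] [y [ly1 ly2]]].
  split; first by split; apply: H2D => //; exact: H2Z.
  exists (a *: x + y); split.
    by apply: circle_ae2 kx1 ly1 => z _ /= -> ->; rewrite transferDl.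
  by apply: circle_ae2 kx2 ly2 => z _ /= -> ->; rewrite transferDl.
- move=> k_ l Kk [Hl1 Hl2] lim0; split=> //.
  have hl1 := Hl1.1; have hl2 := Hl2.1.
  pose x : 'rV[C]_n := \row_i (inner l.1 (T1 (delta_mx 0 i)) + inner l.2 (T2 (delta_mx 0 i))).
  exists x; pose d1 z := l.1 z - T1 x z; pose d2 z := l.2 z - T2 x z.
  have hd1 : L2 d1 by exact: L2B.
  have hd2 : L2 d2 by exact: L2B.
  have dT y : inner d1 (T1 y) + inner d2 (T2 y) = 0.
    rewrite (innerBl hl1 (LT _ _) (LT _ _)) (innerBl hl2 (LT _ _) (LT _ _)).
    have E (a b c d : C) : a - b + (c - d) = (a + c) - (b + d) by ring.
    rewrite E inner_pair.
    rewrite (funext (transfer_delta A y (col ord0 D))) (funext (transfer_delta A y (col (lift ord0 ord0) D))).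
    rewrite !inner_sumr// -big_split /= [X in _ - X]mxE -sumrB big1// => i _.
    by rewrite adjmxE [x 0 i]mxE -mulrDr mulrC subrr.
  have lower m : normL2 d1 ^+ 2 + normL2 d2 ^+ 2 <=
      normH2v_sq (fun z => (k_ m).1 z - l.1 z, fun z => (k_ m).2 z - l.2 z).
    have [[[h1 _] [h2 _]] [y [y1 y2]]] := Kk m.
    pose u1 z := -1 * d1 z + T1 (y - x) z; pose u2 z := -1 * d2 z + T2 (y - x) z.
    have uE v z : transfer A (y - x) v z = transfer A y v z - transfer A x v z.
      by rewrite /transfer !mulmxBl !mxE.
    have hu1 : L2 u1 := L2D (L2Z (-1) hd1) (LT _ _).
    have hu2 : L2 u2 := L2D (L2Z (-1) hd2) (LT _ _).
    have n1 : normL2 (fun z => (k_ m).1 z - l.1 z) ^+ 2 = normL2 u1 ^+ 2.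
      apply: (normL2_sq_ae (L2B h1 hl1) hu1); apply: circle_ae1 y1 => z _ ->.
      by rewrite /u1 uE /d1; move: (l.1 z) (T1 x z) (T1 y z) => a b c; ring.
    have n2 : normL2 (fun z => (k_ m).2 z - l.2 z) ^+ 2 = normL2 u2 ^+ 2.
      apply: (normL2_sq_ae (L2B h2 hl2) hu2); apply: circle_ae1 y2 => z _ ->.
      by rewrite /u2 uE /d2; move: (l.2 z) (T2 x z) (T2 y z) => a b c; ring.
    rewrite /normH2v_sq [X in _ <= X + _]n1 [X in _ <= _ + X]n2.
    suff : inner d1 d1 + inner d2 d2 <= inner u1 u1 + inner u2 u2.
      rewrite (inner_selfE d1) (inner_selfE d2) (inner_selfE u1) (inner_selfE u2).
      by rewrite -!(rmorphD (real_complex R)) lecR.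
    have -> : inner u1 u1 = _ := inner_self_sub hd1 (LT _ _).
    have -> : inner u2 u2 = _ := inner_self_sub hd2 (LT _ _).
    have rearr (a b c d a' b' c' d' : C) : a + b - c - d + (a' + b' - c' - d') =
      (a + a') + ((b + b') - (c + c') - (d + d')) by ring.
    rewrite rearr -conjcD dT conjc0 !subr0 inner_pair mulmx_adj_row lerDl ler0c.
    by apply: sumr_ge0 => i _; exact: sqr_ge0.
  have c0 : normL2 d1 ^+ 2 + normL2 d2 ^+ 2 <= 0.
    by apply: (cvgr_to_ge lim0); exact: nearW.
  have [e1 e2] : normL2 d1 ^+ 2 = 0 /\ normL2 d2 ^+ 2 = 0.
    exact: sum_sqr_le0.
  have z1 : circle_ae d1 (fun=> 0) by apply: inner_eq0 => //; rewrite inner_selfE e1.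
  have z2 : circle_ae d2 (fun=> 0) by apply: inner_eq0 => //; rewrite inner_selfE e2.
  split; first by apply: circle_ae1 z1 => z _ /eqP; rewrite subr_eq0 => /eqP.
  by apply: circle_ae1 z2 => z _ /eqP; rewrite subr_eq0 => /eqP.
Qed.

Lemma backward_shift_transfer f x (v : 'cV[C]_n) : L2 f -> circle_ae f (transfer A x v) ->
  circle_ae (backward_shift f) (transfer A (x *m A) v).
Proof.
move=> hf fx; have LT : L2 (transfer A x v) by exact: L2_transfer.
have f0 : at0 f = (x *m v) 0 0.
  by rewrite -(transfer_at0 AD1 unitA); exact: fourier_ae.
apply: circle_ae1 fx => z z1 fz; rewrite /backward_shift fz f0 transfer_shift//.
by rewrite addrC addKr mulrC mulKf// circle_neq0.
Qed.

Lemma pair_space_shift : backward_shift_invariant pair_space.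
Proof.
move=> k [[k1 k2] [x [kx1 kx2]]]; split; first by split; exact: H2_backward_shift.
by exists (x *m A); split; apply: backward_shift_transfer => //; [case: k1|case: k2].
Qed.

End PairSpace.

(** A square matrix with a left null vector has an adjoint with one, here
    normalised. *)
Lemma singular_adj_kernel (R : realType) n (A : 'M[R[i]]_n) (x : 'rV[R[i]]_n) :
  x != 0 -> x *m A = 0 ->
  exists2 b : 'rV[R[i]]_n, b *m adjmx A = 0 & (b *m adjmx b) 0 0 = 1.
Proof.
move=> x0 xA; have : ~~ row_free (adjmx A).
  apply: contra x0 => /row_freeP[Y AY].
  have YA : adjmx Y *m A = 1%:M by rewrite -(adjmxK A) -adjmxM AY adjmx1.
  by rewrite -[x]mulmx1 -(mulmx1C YA) mulmxA xA mul0mx.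
move=> /nonfree_kernel[b b0 bA].
pose s := \sum_j Normc.normc (b 0 j) ^+ 2.
have s0 : s != 0 by apply: contraNneq b0 => /sum_normc_eq0 ->.
have s_ge0 : 0 <= s by apply: sumr_ge0 => j _; exact: sqr_ge0.
exists ((Num.sqrt s)^-1%:C *: b); first by rewrite -scalemxAl bA scaler0.
rewrite adjmxZ conjc_real -scalemxAl -scalemxAr scalerA mxE mulmx_adj_row.
by rewrite -!(rmorphM (real_complex R)) -expr2 exprVn sqr_sqrtr// mulVf.
Qed.
Theorem theorem6p3 (R : realType) (theta g : R[i] -> R[i])
    (theta_inner : inner_function theta) (g_bounded : Linfty g)
    (ker_fin : finite_dim (ker_dual_TTO theta g)) :
  let gker := mul_set g (ker_dual_TTO theta g) in
  let W := orth_diff gker (mul_set g (setC_of theta g)) in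
  (has_dim W 2 ->
   forall f0 h0 : R[i] -> R[i],
     ker_dual_TTO theta g f0 -> ker_dual_TTO theta g h0 ->
     let gf0 := fun z => g z * f0 z in
     let gh0 := fun z => g z * h0 z in
     let e := fun i : 'I_2 => if i == ord0 then gf0 else gh0 in
     is_basis W e -> is_orthonormal e ->
     exists K : set ((R[i] -> R[i]) * (R[i] -> R[i])),
       [/\ closed_subspace_H2v K,
           backward_shift_invariant K,
           same_classes gker
             ((fun k z => gf0 z * k.1 z + gh0 z * k.2 z) @` K) &
           forall f k, ker_dual_TTO theta g f -> K k ->
             circle_ae (fun z => g z * f z)
                       (fun z => gf0 z * k.1 z + gh0 z * k.2 z) ->
             normL2 (fun z => g z * f z) ^+ 2 =
               normL2 k.1 ^+ 2 + normL2 k.2 ^+ 2]) /\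
  (has_dim W 1 ->
   forall f0 : R[i] -> R[i],
     ker_dual_TTO theta g f0 ->
     let gf0 := fun z => g z * f0 z in
     W gf0 -> normL2 gf0 = 1 ->
     exists chi : R[i] -> R[i],
       [/\ inner_function chi,
           same_classes gker (mul_set gf0 (model_space (fun z => chi z * z))) &
           forall f k, ker_dual_TTO theta g f ->
             model_space (fun z => chi z * z) k ->
             circle_ae (fun z => g z * f z) (fun z => gf0 z * k z) ->
             normL2 (fun z => g z * f z) ^+ 2 = normL2 k ^+ 2]).
Proof.
move=> gker W; have WL f : W f -> L2 f by case=> /(gker_L2 g_bounded).
split.
- move=> _ f0 h0 kf0 kh0 gf0 gh0 e be oe.
  have We i : W (e i) by case: be.
  have he i : L2 (e i) by exact: WL.
  have [n [A [D [AD1 unitA surj inj iso]]]] := gker_parametrization g_bounded ker_fin We oe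
    (basis_orth_proj he oe be WL).
  pose T1 x := transfer A x (col ord0 D).
  pose T2 x := transfer A x (col (lift ord0 ord0) D).
  have eT x z : \sum_j e j z * transfer A x (col j D) z = gf0 z * T1 x z + gh0 z * T2 x z.
    by rewrite big_ord_recl big_ord1.
  have LT x v : L2 (transfer A x v) by exact: L2_transfer.
  exists (pair_space A D); split.
  + exact: pair_space_closed.
  + exact: pair_space_shift.
  + split=> [f Mf|_ [k [_ [x [k1x k2x]]] <-]].
      have [x fx _] := surj _ Mf.
      exists (fun z => gf0 z * T1 x z + gh0 z * T2 x z).
        exists (T1 x, T2 x) => //; split; first by split; exact: (H2_transfer AD1 unitA).
        by exists x; split; exact: circle_ae_refl.
      by apply: circle_ae1 fx => z _ ->; exact: eT.
    have [f Mf fx] := inj x; exists f => //.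
    apply: (circle_ae_trans fx); apply: circle_ae2 k1x k2x => z _ -> ->; exact: eT.
  + move=> f k kf [[[hk1 _] [hk2 _]] [x [k1x k2x]]] fE.
    have fx : circle_ae (fun z => g z * f z) (fun z => \sum_j e j z * transfer A x (col j D) z).
      apply: (circle_ae_trans fE); apply: circle_ae2 k1x k2x => z _ -> ->.
      by rewrite eT.
    have Mf : gker (fun z => g z * f z) by exists f.
    rewrite [LHS]normL2_sq (iso _ _ Mf fx) -(normL2_pair AD1 unitA).
    by congr (_ + _); apply: esym; [exact: normL2_sq_ae k1x|exact: normL2_sq_ae k2x].
- move=> [u [Wu usp _]] f0 kf0 gf0 Wgf0 ngf0.
  have hgf0 := WL _ Wgf0.
  have gf01 : inner gf0 gf0 = 1 by rewrite inner_selfE ngf0 expr1n.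
  (* A unit vector of a one-dimensional space spans it. *)
  pose w := fun _ : 'I_1 => gf0.
  have ow : is_orthonormal w by move=> i j; rewrite !ord1 eqxx.
  have [c gf0c] := usp _ Wgf0.
  have wb : is_basis W w.
    split=> // [f Wf|c' c'0 i].
      have [a fa] := usp _ Wf; exists (fun=> a ord0 / c ord0).
      have c0 : c ord0 != 0.
        apply: contra_eqN gf01 => /eqP c00.
        have gf00 : circle_ae gf0 (fun=> 0).
          by apply: circle_ae1 gf0c => z _ ->; rewrite big_ord1 c00 mul0r.
        rewrite (inner_ae hgf0 (L2_cst 0) hgf0 hgf0 gf00 (circle_ae_refl _)) inner0l.
        by rewrite eq_sym oner_eq0.
      apply: circle_ae2 fa gf0c => z _ -> E; rewrite /w big_ord1 E !big_ord1 mulrA.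
      by rewrite divfK.
    have := @orthonormal_comb_eq0 R 1 w (\row_i c' i) (fun=> hgf0) ow.
    have -> : (fun z => \sum_i (\row_i c' i) 0 i * w i z) = (fun z => \sum_i c' i * w i z).
      by apply/funext => z; apply: eq_bigr => j _; rewrite mxE.
    by move=> /(_ c'0)/rowP/(_ i); rewrite !mxE.
  have [n [A [D [AD1 unitA surj inj iso]]]] := gker_parametrization g_bounded ker_fin (fun=> Wgf0) ow
    (basis_orth_proj (fun=> hgf0) ow wb WL).
  have eT x z : \sum_j w j z * transfer A x (col j D) z = gf0 z * transfer A x D z.
    by rewrite big_ord1 col_ord0.
  have [x gf0x xD] := surj _ (Wgf0.1).
  have xx : (x *m adjmx x) 0 0 = 1 by rewrite -(iso _ _ Wgf0.1 gf0x).
  (* The coordinates x of gf0 satisfy xD = <gf0, gf0> = 1, which leaves no room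
     for xA in |x|^2 = 1. *)
  have xA : x *m A = 0.
    apply: mulmx_adj_eq0.
    have := mulmx_adj_split x AD1.
    have -> : x *m adjmx x = 1%:M.
      by apply/matrixP => i j; rewrite !ord1 xx mxE.
    have -> : x *m D *m adjmx (x *m D) = 1%:M.
      apply/matrixP => i j; rewrite !ord1 xD [LHS]mxE big_ord1 adjmxE !mxE.
      by rewrite gf01 conjc1 mulr1.
    by move=> E; apply: (addIr 1%:M); rewrite add0r -E.
  have x0 : x != 0.
    by apply: contra_eqN xx => /eqP ->; rewrite mul0mx mxE eq_sym oner_eq0.
  have [b bA b1] := singular_adj_kernel x0 xA.
  have Lx y : L2 (transfer A y D) by exact: L2_transfer.
  exists (blaschke A D b); split.
  + exact: inner_function_blaschke.
  + split=> [f Mf|_ [k mk <-]].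
      have [y fy _] := surj _ Mf.
      exists (fun z => gf0 z * transfer A y D z).
        by exists (transfer A y D) => //; exact: transfer_model_space.
      by apply: circle_ae1 fy => z _ ->; exact: eT.
    have [y ky] := model_space_blaschke_sub AD1 unitA bA b1 mk.
    have [f Mf fy] := inj y; exists f => //.
    by apply: circle_ae2 fy ky => z _ -> ->; exact: eT.
  + move=> f k kf mk fE; have [y ky] := model_space_blaschke_sub AD1 unitA bA b1 mk.
    have fy : circle_ae (fun z => g z * f z) (fun z => \sum_j w j z * transfer A y (col j D) z).
      by apply: circle_ae2 fE ky => z _ -> ->; rewrite eT.
    have Mf : gker (fun z => g z * f z) by exists f.
    rewrite [LHS]normL2_sq (iso _ _ Mf fy) -(inner_transfer1 AD1 unitA) -normL2_sq.
    exact: esym (normL2_sq_ae mk.1.1 (Lx y) ky).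
Qed.
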